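(* For every real $k\in[1,\log n]$ and every integer $g\in[1,\log k]$, there is a dynamic stream algorithm using $g\cdot\left(\left\lceil (\frac{k+1}{2})^{1/g}\right\rceil-1\right)+1<g\cdot k^{1/g}+1$ passes that, given an unweighted undirected $n$-vertex graph $G=(V,E)$, uses $\widetilde{O}(n^{1+\frac1k})$ space and computes, with high probability, a spanner $H$ of $G$ with $\widetilde{O}(n^{1+\frac1k})$ edges and stretch $$2\cdot\left(2\cdot\left\lceil (\tfrac{k+1}{2})^{1/g}\right\rceil-1\right)^{g}-1.$$
   Context: Dynamic stream model: a fixed vertex set $V$ of $n$ vertices is known; the edges of $G$ are given as a stream of edge insertions and deletions; a $p$-pass algorithm may read the stream $p$ times in order, with limited memory (space, in bits) throughout. A subgraph $H$ of $G$ is a spanner with stretch $t$ if $d_H(u,v)\le t\cdot d_G(u,v)$ for all $u,v\in V$ ($d$ = shortest-path distance). All logarithms are base $2$. $\widetilde{O}(f)$ means $f\cdot\mathrm{polylog}(n)$; ''with high probability'' means with probability at least $1-1/\mathrm{poly}(n)$. *)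

(* Defs.v *)
From HB Require Import structures.
From mathcomp Require Import all_boot all_order all_algebra.
From mathcomp Require Import boolp reals exp.
Set Implicit Arguments. Unset Strict Implicit. Unset Printing Implicit Defensive.
Import Order.TTheory GRing.Theory Num.Theory.
Local Open Scope ring_scope.

(* An undirected edge {u,v} is represented canonically by the pair (u,v), u < v. *)
Definition Edge (n : nat) := {e : 'I_n * 'I_n | (e.1 < e.2)%N}.

Definition adj n (E : {set Edge n}) (u v : 'I_n) : Prop :=
  exists2 e : Edge n, e \in E &
    ((val e).1 = u /\ (val e).2 = v) \/ ((val e).1 = v /\ (val e).2 = u).

Fixpoint walk n (E : {set Edge n}) (d : nat) (u v : 'I_n) : Prop :=
  match d with
  | 0 => u = v
  | d'.+1 => exists w, adj E u w /\ walk E d' w v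
  end.

(* H is a spanner of G with stretch t:  H subgraph of G and
   d_H(u,v) <= t * d_G(u,v) for all u, v (d = shortest-path distance, with
   the convention that the inequality is vacuous when d_G(u,v) = +oo). *)
Definition is_spanner n (G H : {set Edge n}) (t : int) : Prop :=
  H \subset G /\
  forall (u v : 'I_n) (d : nat), walk G d u v ->
    exists d' : nat, (d'%:Z <= t * d%:Z) /\ walk H d' u v.

(* an update is an edge together with true = insertion / false = deletion *)
Definition update n := (Edge n * bool)%type.

Definition mult n (s : seq (update n)) (e : Edge n) : int :=
  (count (fun x => (x.1 == e) && x.2) s)%:Z - (count (fun x => (x.1 == e) && ~~ x.2) s)%:Z.

Definition valid_stream n (s : seq (update n)) : Prop :=
  forall i (e : Edge n), mult (take i s) e = 0 \/ mult (take i s) e = 1.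

Definition graph_of n (s : seq (update n)) : {set Edge n} :=
  [set e | mult s e == 1].

(* The memory is a string of s bits.  The randomness of the algorithm is the
   initial content of the memory, drawn uniformly at random (so random bits
   count towards the space).  In pass i the algorithm reads the updates in
   order, updating its memory by step i; after the pass it may process its
   memory by endpass i; at the end it outputs an edge set computed from the
   memory. *)
Definition memory (s : nat) := {ffun 'I_s -> bool}.

Record stream_alg (n s p : nat) := StreamAlg {
  step : 'I_p -> memory s -> update n -> memory s;
  endpass : 'I_p -> memory s -> memory s;
  output : memory s -> {set Edge n} }.

Definition run_pass n s p (A : stream_alg n s p) (i : 'I_p)
  (str : seq (update n)) (m : memory s) : memory s :=
  endpass A i (foldl (step A i) m str).

Definition run n s p (A : stream_alg n s p) (str : seq (update n))
  (seed : memory s) : {set Edge n} :=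
  output A (foldl (fun m i => run_pass A i str m) seed (enum 'I_p)).

Definition nfail n s (Pr : {set Edge n} -> Prop) p (A : stream_alg n s p)
  (str : seq (update n)) : nat :=
  #|[set seed : memory s | ~~ `[< Pr (run A str seed) >] ]|.

Definition log2 {R : realType} (x : R) : R := ln x / ln 2.

(* Main.v *)
Require Import Defs.
From HB Require Import structures.
From mathcomp Require Import all_boot all_order all_algebra.
From mathcomp Require Import boolp reals exp.
From mathcomp Require Import zify ring lra.
Import Order.TTheory GRing.Theory Num.Theory.

(** The algorithm is a clustering in the style of Baswana and Sen, run in [g] phases of
    [m - 1] passes on successively contracted graphs, plus one last pass. In a pass the
    centres are coloured at random and only the smallest colour class survives. A
    supernode whose cluster dies joins an adjacent surviving cluster if there is one;
    otherwise it keeps one edge to each adjacent cluster and leaves. A supernode adjacent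
    to many clusters sees all colours with high probability, so few edges are kept, and
    the number of surviving centres is bounded deterministically. If supernodes have
    radius [r], a pass increases the cluster radius by [2 r + 1], so a phase multiplies
    [2 r + 1] by [2 m - 1].

    On a valid stream the parity of the number of updates of an edge is its final
    multiplicity, so every parity over the edges of the graph can be maintained under
    updates. An edge between vertex sets [S] and [Z] is found from such parities as
    follows: thin [Z] and [S] by nested random chains of vertex sets, again keeping the
    smaller of two colour classes at each level. Because a set with many elements meets
    both classes, the last nonempty level contains few edges with high probability, and
    these are decoded from a Gilbert-Varshamov parity code. Levels behind it are empty and
    have zero syndrome, so no further verification is needed. A second parity code over
    the centres recovers the edges to all adjacent clusters when these are few. *)

Set Implicit Arguments. Unset Strict Implicit. Unset Printing Implicit Defensive.

(** * Parity codes *)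

Definition parity (T : finType) (w : T -> bool) (X : {set T}) : bool :=
  \big[addb/false]_(x in X) w x.

Definition symdiff (T : finType) (X Y : {set T}) : {set T} :=
  [set x | (x \in X) (+) (x \in Y)].

Lemma parityE (T : finType) (w : T -> bool) (X : {set T}) :
  parity w X = \big[addb/false]_x ((x \in X) && w x).
Proof. by rewrite /parity big_mkcond; apply: eq_bigr => x _; case: (x \in X). Qed.

Lemma parity_symdiff (T : finType) (w : T -> bool) (X Y : {set T}) :
  parity w (symdiff X Y) = parity w X (+) parity w Y.
Proof.
rewrite !parityE -big_split; apply: eq_bigr => x _.
by rewrite inE; case: (x \in X); case: (x \in Y); case: (w x).
Qed.

Lemma parity_flip (T : finType) (w w' : T -> bool) (Z : {set T}) z :
  z \in Z -> (forall x, w' x = (x == z) (+) w x) -> parity w' Z = ~~ parity w Z.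
Proof.
move=> zZ E; rewrite /parity (bigD1 z) //= [in RHS](bigD1 z) //= E eqxx -addNb.
by congr (_ (+) _); apply: eq_bigr => x /andP[_ /negbTE xz]; rewrite E xz.
Qed.

(** Flipping [w] at one point of [Z] is an involution that exchanges odd and even parity. *)
Lemma card_parity_half (T : finType) (Z : {set T}) : Z != set0 ->
  2 * #|[set w : {ffun T -> bool} | ~~ parity w Z]| = #|{ffun T -> bool}|.
Proof.
case/set0Pn => z zZ.
pose h (w : {ffun T -> bool}) := [ffun x => (x == z) (+) w x].
have hK : involutive h.
  by move=> w; apply/ffunP => x; rewrite !ffunE; case: (x == z); case: (w x).
have hp w : parity (h w) Z = ~~ parity w Z.
  by apply: (@parity_flip _ _ _ _ z zZ) => x; rewrite ffunE.
set X := [set w | _].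
have E : ~: X = h @: X.
  apply/setP => w; rewrite !inE negbK; apply/idP/imsetP => [pw|[v]].
    by exists (h w); rewrite ?hK // inE hp pw.
  by rewrite inE => pv ->; rewrite hp.
by rewrite mul2n -addnn -(cardsC X) E card_imset //; apply: inv_inj.
Qed.

Lemma card_set_sum (T : finType) (A : {set T}) (p : pred T) :
  #|[set x in A | p x]| = \sum_(x in A) p x.
Proof.
rewrite -sum1_card big_mkcond [RHS]big_mkcond; apply: eq_bigr => x _.
by rewrite inE; case: (x \in A); case: (p x).
Qed.

(** Averaging over [w]: each [Z] has even parity for exactly half of all [w]. *)
Lemma exists_halving (T : finType) (F : {set {set T}}) :
  (forall Z, Z \in F -> Z != set0) ->
  exists w : {ffun T -> bool}, 2 * #|[set Z in F | ~~ parity w Z]| <= #|F|.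
Proof.
move=> F0; apply/existsP; case: existsP => // H.
have {}H : forall w : {ffun T -> bool}, #|F| < 2 * #|[set Z in F | ~~ parity w Z]|.
  by move=> w; rewrite ltnNge; apply/negP => ?; apply: H; exists w.
have : \sum_(w : {ffun T -> bool}) #|F| <
       \sum_(w : {ffun T -> bool}) 2 * #|[set Z in F | ~~ parity w Z]|.
  (* One term is split off to keep the inequality strict. *)
  rewrite (bigD1 [ffun=> true]) //= [X in _ < X](bigD1 [ffun=> true]) //=.
  by rewrite -addSn leq_add // leq_sum // => w _; apply: ltnW.
suff -> : \sum_(w : {ffun T -> bool}) 2 * #|[set Z in F | ~~ parity w Z]| =
          \sum_(w : {ffun T -> bool}) #|F| by rewrite ltnn.
rewrite sum_nat_const mulnC -sum_nat_const.
transitivity (\sum_(Z in F) 2 * #|[set w : {ffun T -> bool} | ~~ parity w Z]|).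
  rewrite -!big_distrr /=; congr (_ * _).
  under eq_bigr do rewrite card_set_sum.
  rewrite exchange_big; apply: eq_bigr => Z _.
  by rewrite -sum1_card [RHS]big_mkcond; apply: eq_bigr => w _; rewrite inE; case: (parity w Z).
by apply: eq_bigr => Z ZF; rewrite card_parity_half ?F0.
Qed.

(** Each further [w] at least halves the family not yet separated, so [r] of them leave nothing of
    fewer than [2 ^ r] sets. *)
Lemma exists_separating (T : finType) r (F : {set {set T}}) :
  (forall Z, Z \in F -> Z != set0) -> #|F| < 2 ^ r ->
  exists2 ws : seq {ffun T -> bool}, size ws = r &
    forall Z, Z \in F -> has (fun w : {ffun T -> bool} => parity w Z) ws.
Proof.
elim: r F => [|r IH] F F0 Fr.
  exists [::] => // Z ZF; move: Fr; rewrite expn0 ltnS leqn0 cards_eq0 => /eqP E.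
  by rewrite E inE in ZF.
have [w Hw] := exists_halving F0.
have [||ws sz Hws] := IH [set Z in F | ~~ parity w Z].
- by move=> Z; rewrite inE => /andP[/F0].
- by move: Fr; rewrite expnS; lia.
exists (w :: ws) => /= [|Z ZF]; first by rewrite sz.
by case: (boolP (parity w Z)) => //= nw; apply: Hws; rewrite inE ZF.
Qed.

(** A set of at most [m] elements is the range of a map from ['I_m] to [option T], with [None] as
    padding. *)
Lemma card_small_sets (T : finType) m :
  #|[set X : {set T} | #|X| <= m]| <= #|T|.+1 ^ m.
Proof.
pose f (t : {ffun 'I_m -> option T}) : {set T} := [set x | [exists i, t i == Some x]].
have <- : #|{ffun 'I_m -> option T}| = #|T|.+1 ^ m.
  by rewrite card_ffun card_option card_ord.
apply: leq_trans (leq_imset_card f _); apply: subset_leq_card.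
apply/subsetP => X; rewrite inE => Xm; apply/imsetP.
exists [ffun i : 'I_m => onth (enum X) i] => //.
apply/setP => x; rewrite inE; apply/idP/existsP => [xX|[i]].
  have xe : index x (enum X) < m by apply: leq_trans Xm; rewrite cardE index_mem mem_enum.
  by exists (Ordinal xe); rewrite ffunE onthE (nth_map x) ?index_mem ?mem_enum // nth_index // mem_enum.
by rewrite ffunE => /eqP xe; rewrite -mem_enum; apply/onthP; exists i.
Qed.

(** The Gilbert-Varshamov argument: sets with equal syndromes differ by a set of at most [m + m]
    elements with zero syndrome, and the separating family leaves only the empty one. *)
Lemma parity_code (T : finType) m r : #|T|.+1 ^ (m + m) < 2 ^ r ->
  exists w : 'I_r -> T -> bool, forall X Y : {set T},
    #|X| <= m -> #|Y| <= m -> (forall i, parity (w i) X = parity (w i) Y) -> X = Y.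
Proof.
move=> Tr; pose F := [set X : {set T} | #|X| <= m + m] :\ set0.
have [||ws sz Hws] := @exists_separating T r F.
- by move=> Z; rewrite !inE => /andP[].
- apply: leq_ltn_trans Tr; apply: leq_trans (card_small_sets _ _).
  by apply: subset_leq_card; apply: subsetDl.
exists (fun i => nth [ffun=> false] ws i) => X Y Xm Ym E.
apply/eqP; apply: contraT => XY.
have /Hws /hasP[w wws] : symdiff X Y \in F.
  rewrite !inE; apply/andP; split.
    apply: contraNneq XY => D0; apply/eqP/setP => x; have : x \notin symdiff X Y by rewrite D0 inE.
    by rewrite inE; case: (x \in X); case: (x \in Y).
  apply: leq_trans (leq_add Xm Ym); apply: leq_trans (leq_card_setU X Y).
  by apply: subset_leq_card; apply/subsetP => x; rewrite !inE; case: (x \in X); case: (x \in Y).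
have wi : index w ws < r by rewrite -sz index_mem.
by have := E (Ordinal wi); rewrite /= nth_index // parity_symdiff => ->; rewrite addbb.
Qed.

Lemma sparse_decoder (T : finType) m r : #|T|.+1 ^ (m + m) < 2 ^ r ->
  exists (w : 'I_r -> T -> bool) (dec : {ffun 'I_r -> bool} -> {set T}),
    forall X : {set T}, #|X| <= m -> dec [ffun i => parity (w i) X] = X.
Proof.
move/parity_code => [w wP]; exists w.
exists (fun v => odflt set0 [pick X : {set T} | (#|X| <= m) && (v == [ffun i => parity (w i) X])]).
move=> X Xm; case: pickP => [Y /andP[Ym /eqP E]|/(_ X)]; last by rewrite Xm eqxx.
by apply: wP => // i; move/ffunP/(_ i): E; rewrite !ffunE.
Qed.

(** * Linear sketches as streaming algorithms *)

Lemma parity_stream n (w : Edge n -> bool) (str : seq (update n)) :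
  valid_stream str ->
  \big[addb/false]_(x <- str) w x.1 = parity w (graph_of str).
Proof.
move=> vs; transitivity (\big[addb/false]_e (odd (count (fun x => x.1 == e) str) && w e)).
  elim: str {vs} => [|x str IH].
    by rewrite big_nil big1.
  rewrite big_cons IH (bigD1 x.1) //= [in RHS](bigD1 x.1) //= addbA; congr (_ (+) _).
    by rewrite eqxx oddD /=; case: (w x.1); rewrite ?andbT ?andbF.
  by apply: eq_bigr => e /negbTE ne; rewrite eq_sym ne.
rewrite parityE; apply: eq_bigr => e _; congr (_ && _); rewrite inE.
have := vs (size str) e; rewrite take_size /mult.
have -> : count (fun x : update n => x.1 == e) str =
  count (fun x => (x.1 == e) && x.2) str + count (fun x => (x.1 == e) && ~~ x.2) str.
  by elim: str {vs} => //= x str ->; case: (x.1 == e) => //=; case: x.2; lia.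
move: (count _ _) (count _ _) => c2 c1 H.
have [<-|->] : c1 = c2 \/ c1 = c2.+1.
  case: H => /eqP; rewrite subr_eq ?add0r => /eqP E; first by left; case: E => ->.
  by right; case: E => ->; rewrite add1n.
  by rewrite subrr addnn odd_double.
rewrite addSn addnn /= odd_double /= -(addn1 c2) PoszD addrAC subrr add0r.
by rewrite eqxx.
Qed.

Lemma card_eq_bij (T1 T2 : finType) : #|T1| = #|T2| ->
  exists (h : T1 -> T2) (h' : T2 -> T1), cancel h h' /\ cancel h' h.
Proof.
move=> E.
exists (fun x => enum_val (cast_ord E (enum_rank x))).
exists (fun x => enum_val (cast_ord (esym E) (enum_rank x))).
by split=> x; rewrite enum_valK ?cast_ordK ?cast_ordKV enum_rankK.
Qed.

Lemma card_le_enc (T1 T2 : finType) (x0 : T1) : #|T1| <= #|T2| ->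
  exists (h : T1 -> T2) (h' : T2 -> T1), cancel h h'.
Proof.
move=> E; exists (fun x => enum_val (widen_ord E (enum_rank x))).
exists (fun y => nth x0 (enum T1) (enum_rank y)) => x.
by rewrite enum_valK /= nth_enum_rank.
Qed.

Lemma card_preim_bij (T1 T2 : finType) (h : T1 -> T2) h' (P : pred T2) :
  cancel h h' -> cancel h' h -> #|[set x | P (h x)]| = #|[set y | P y]|.
Proof.
move=> hK h'K; rewrite -(card_imset _ (can_inj hK)); apply: eq_card => y.
rewrite inE; apply/imsetP/idP => [[x]|Py]; first by rewrite inE => Px ->.
by exists (h' y); rewrite ?inE h'K.
Qed.

Definition sketch n b (w : 'I_b -> Edge n -> bool) (G : {set Edge n}) :
  {ffun 'I_b -> bool} := [ffun i => parity (w i) G].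

Section Machine.
Variables (n p a b f rho : nat) (PS St : finType) (st0 : St).
Variable W : 'I_p -> PS -> St -> 'I_b -> Edge n -> bool.
Variable next : 'I_p -> PS -> St -> {ffun 'I_b -> bool} -> St.
Variable out : St -> {set Edge n}.
Hypothesis cardPS : #|PS| = 2 ^ rho.
Hypothesis cardSt : #|St| <= 2 ^ a.

(** The idealised algorithm sees the exact sketch of [G]; the parities it asks for may depend on the
    state and on the seed of the pass. *)
Definition ideal_pass G (seed : {ffun 'I_p -> PS}) st i :=
  next i (seed i) st (sketch (W i (seed i) st) G).

Definition ideal_run (seed : {ffun 'I_p -> PS}) G :=
  foldl (ideal_pass G seed) st0 (enum 'I_p).

Definition registers := (memory f * {ffun 'I_p -> PS} * (memory a * memory b))%type.

(* The initial memory is uniformly random, also in the part that holds the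
   state.  A nonzero flag field marks a memory that is still uninitialised;
   the flag is accidentally zero at the start with probability 2^-f only. *)
Definition normalise enc (x : registers) : registers :=
  if x.1.1 == [ffun=> false] then x else ([ffun=> false], x.1.2, (enc st0, [ffun=> false])).

Lemma card_registers : #|{: registers}| = #|{: memory (f + p * rho + a + b)}|.
Proof.
rewrite !card_prod !card_ffun !card_bool !card_ord cardPS.
by rewrite -expnM mulnC (mulnC rho) !expnD; lia.
Qed.

(** A failing initial memory either has a zero flag, which the first summand counts, or holds bad
    seeds, which leave [2 ^ (f + a + b)] choices for the other registers. *)
Lemma linear_stream_alg : exists A : stream_alg n (f + p * rho + a + b) p,
  forall str, valid_stream str -> forall Pr : {set Edge n} -> Prop,
  nfail Pr A str <= 2 ^ (p * rho + a + b) +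
    #|[set seed | ~~ `[< Pr (out (ideal_run seed (graph_of str))) >]]| * 2 ^ (f + a + b).
Proof.
have [enc [dec encK]] : exists (h : St -> memory a) h', cancel h h'.
  by apply: card_le_enc st0 _; rewrite card_ffun card_bool card_ord.
(* A bijection is needed, not just an encoding, so that a uniform memory means uniform registers. *)
have [h' [h [h'K hK]]] := card_eq_bij card_registers.
pose nm m := normalise enc (h m).
pose z l : memory l := [ffun=> false].
(* Each operation normalises first and writes a zero flag, so initialisation takes effect at most
   once. *)
pose A := @StreamAlg n (f + p * rho + a + b) p
  (fun i m u => let: (_, seed, (sta, sk)) := nm m in
     h' (z f, seed, (sta, [ffun k => sk k (+) W i (seed i) (dec sta) k u.1])))
  (fun i m => let: (_, seed, (sta, sk)) := nm m in
     h' (z f, seed, (enc (next i (seed i) (dec sta) sk), z b)))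
  (fun m => let: (_, seed, (sta, sk)) := nm m in out (dec sta)).
exists A => str vs Pr.
have nmE seed sta sk : nm (h' (z f, seed, (sta, sk))) = (z f, seed, (sta, sk)).
  by rewrite /nm h'K /normalise /= eqxx.
have stepP i seed st : forall s m sk, nm m = (z f, seed, (enc st, sk)) ->
    nm (foldl (step A i) m s) =
    (z f, seed, (enc st, [ffun k => sk k (+) \big[addb/false]_(x <- s) W i (seed i) st k x.1])).
  elim=> [|x s IH] m sk E /=.
    by rewrite E; congr (_, _, (_, _)); apply/ffunP => k; rewrite ffunE big_nil addbF.
  rewrite E (IH _ [ffun k => sk k (+) W i (seed i) st k x.1]) ?nmE ?encK //.
  by congr (_, _, (_, _)); apply/ffunP => k; rewrite !ffunE big_cons addbA.
have passP i seed st m : nm m = (z f, seed, (enc st, z b)) ->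
    nm (run_pass A i str m) = (z f, seed, (enc (ideal_pass (graph_of str) seed st i), z b)).
  move=> E; rewrite /run_pass /= (stepP i _ _ str _ _ E) nmE encK.
  congr (_, _, (enc (next _ _ _ _), _)); apply/ffunP => k.
  by rewrite !ffunE /= parity_stream.
have runP seed m : nm m = (z f, seed, (enc st0, z b)) ->
    run A str m = out (ideal_run seed (graph_of str)).
  rewrite /run /ideal_run; elim: (enum _) (st0) m => [|i s IH] st m E /=.
    by rewrite E encK.
  by apply: IH; apply: passP.
pose bad seed := ~~ `[< Pr (out (ideal_run seed (graph_of str))) >].
rewrite /nfail.
have sub : [set m | ~~ `[< Pr (run A str m) >]] \subset
    [set m | ((h m).1.1 == z f)] :|: [set m | bad (h m).1.2].
  apply/subsetP => m; rewrite !inE; case: eqP => // fm; rewrite /bad -(runP (h m).1.2 m) //.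
  by rewrite /nm /normalise; case: eqP.
apply: leq_trans (subset_leq_card sub) _; apply: leq_trans (leq_card_setU _ _) _.
rewrite (card_preim_bij (fun x : registers => x.1.1 == z f) hK h'K).
rewrite (card_preim_bij (fun x : registers => bad x.1.2) hK h'K).
have -> : [set y : registers | y.1.1 == z f] = setX (setX [set z f] setT) setT.
  by apply/setP => -[[y1 y2] y3]; rewrite !inE /= !andbT.
have -> : [set y : registers | bad y.1.2] = setX (setX setT [set seed | bad seed]) setT.
  by apply/setP => -[[y1 y2] y3]; rewrite !inE /= !andbT.
rewrite !cardsX cards1 !cardsT card_prod !card_ffun !card_bool !card_ord cardPS.
by rewrite -!expnM !expnD (mulnC rho) mul1n !mulnA leq_add2l (mulnC (2 ^ f)).
Qed.
End Machine.

(** * Random colourings *)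

Definition upd (J O : finType) (w : {ffun J -> O}) (r : J) (x : O) : {ffun J -> O} :=
  [ffun j => if j == r then x else w j].

Lemma updE (J O : finType) (w : {ffun J -> O}) r x : upd w r x r = x.
Proof. by rewrite ffunE eqxx. Qed.

Lemma card_pred_sum (T : finType) (P : pred T) : #|[set x | P x]| = \sum_x P x.
Proof.
by rewrite -sum1_card big_mkcond; apply: eq_bigr => x _; rewrite inE; case: (P x).
Qed.

(** Probabilities are stated without fractions: [#|X| * 2 ^ s <= M * N] says that [X] has
    probability at most [M / 2 ^ s] among [N] outcomes. *)
Lemma card_union_bound (I T : finType) (P : I -> pred T) s M N :
  (forall i, #|[set x | P i x]| * 2 ^ s <= M * N) ->
  #|[set x | [exists i, P i x]]| * 2 ^ s <= #|I| * M * N.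
Proof.
move=> H; apply: (@leq_trans (\sum_i #|[set x | P i x]| * 2 ^ s)); last first.
  rewrite -mulnA -sum_nat_const; apply: leq_sum => i _; exact: H.
rewrite -big_distrl leq_mul2r /=; apply/orP; right.
under eq_bigr do rewrite card_pred_sum.
rewrite card_pred_sum exchange_big; apply: leq_sum => x _.
case: existsP => //= -[i Pi]; rewrite (bigD1 i) //= Pi; lia.
Qed.

(* Whether the event [bad r] occurs may depend on the whole history [w]; only
   its conditional probability given the other coordinates is controlled. *)
Lemma card_history (J O : finType) (bad : J -> {ffun J -> O} -> bool) s M :
  0 < #|O| ->
  (forall r w, #|[set x | bad r (upd w r x)]| * 2 ^ s <= M * #|O|) ->
  #|[set w | [exists r, bad r w]]| * 2 ^ s <= #|J| * M * #|{ffun J -> O}|.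
Proof.
move=> O0 H; apply: card_union_bound => r.
rewrite -(leq_pmul2r O0) mulnAC.
have -> : #|[set w | bad r w]| * #|O| = \sum_w #|[set x | bad r (upd w r x)]|.
  rewrite card_pred_sum big_distrl /=.
  under eq_bigr do rewrite mulnC -sum_nat_const.
  under [RHS]eq_bigr do rewrite card_pred_sum.
  (* Exchanging [x] with the value of [w] at [r] is an involution on pairs, so redrawing coordinate
     [r] preserves the count. *)
  rewrite !pair_big /= [RHS](reindex (fun z => (upd z.1 r z.2, z.1 r))) /=; last first.
    exists (fun z => (upd z.1 r z.2, z.1 r)) => -[w x] _ /=; congr (_, _);
      rewrite ?ffunE ?eqxx //; apply/ffunP => j; rewrite !ffunE; by case: eqP => // ->.
  by apply: eq_bigr => -[w x] _ /=; congr (nat_of_bool (bad r _)); apply/ffunP => j;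
    rewrite !ffunE; case: eqP => // ->.
rewrite big_distrl /= -mulnA (mulnC #|{ffun _}|) mulnA mulnC -[X in _ <= X]sum_nat_const.
by apply: leq_sum.
Qed.

(** A union bound in two stages, where the second event may depend on the first draw. *)
Lemma card_pair_bad (A B : finType) (P : pred A) (Q : A -> pred B) s M1 M2 :
  #|[set a | P a]| * 2 ^ s <= M1 * #|A| ->
  (forall a, #|[set b | Q a b]| * 2 ^ s <= M2 * #|B|) ->
  #|[set z : A * B | P z.1 || Q z.1 z.2]| * 2 ^ s <= (M1 + M2) * #|{: A * B}|.
Proof.
move=> HP HQ; rewrite card_prod.
apply: (@leq_trans ((#|[set z : A * B | P z.1]| + #|[set z : A * B | Q z.1 z.2]|) * 2 ^ s)).
  rewrite leq_mul2r; apply/orP; right; apply: leq_trans (leq_card_setU _ _).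
  by apply: subset_leq_card; apply/subsetP => z; rewrite !inE.
rewrite mulnDl mulnDl leq_add //.
  have -> : [set z : A * B | P z.1] = setX [set a | P a] setT.
    by apply/setP => -[a b]; rewrite !inE andbT.
  by rewrite cardsX cardsT mulnAC mulnA leq_mul2r HP orbT.
have -> : #|[set z : A * B | Q z.1 z.2]| = \sum_a #|[set b | Q a b]|.
  rewrite card_pred_sum; under [RHS]eq_bigr do rewrite card_pred_sum.
  by rewrite pair_big.
by rewrite big_distrl /= (mulnC #|A|) mulnA mulnC -[X in _ <= X]sum_nat_const; apply: leq_sum.
Qed.

Lemma count_modn K c Q : c < K -> count (fun x => x %% K == c) (iota 0 (Q * K)) = Q.
Proof.
move=> cK; elim: Q => [|Q IH]; first by rewrite mul0n.
rewrite mulSn addnC iotaD count_cat IH add0n -[X in iota X _](addn0 (Q * K)) iotaDl count_map.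
rewrite (eq_in_count (a2 := pred1 c)); last first.
  by move=> x; rewrite mem_iota add0n /= => xK; rewrite modnMDl modn_small.
by rewrite count_uniq_mem ?iota_uniq // mem_iota add0n cK addn1.
Qed.

(** All residues modulo [2 ^ k] are equally frequent among [b]-bit numbers, so one [b]-bit value
    serves as a uniform colour for every [k <= b]. *)
Lemma card_modn_neq k b c : k <= b -> c < 2 ^ k ->
  #|[set x : 'I_(2 ^ b) | x %% 2 ^ k != c]| * 2 ^ k = (2 ^ k).-1 * 2 ^ b.
Proof.
move=> kb cK.
have E : #|[set x : 'I_(2 ^ b) | x %% 2 ^ k == c]| = 2 ^ (b - k).
  rewrite -[RHS](count_modn _ cK) -expnD subnK //.
  rewrite cardE size_filter -(val_enum_ord (2 ^ b)) count_map -enumT.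
  by apply: eq_count => x; rewrite inE [LHS]inE.
have := cardsC [set x : 'I_(2 ^ b) | x %% 2 ^ k == c].
rewrite E card_ord.
have -> : ~: [set x : 'I_(2 ^ b) | x %% 2 ^ k == c] = [set x : 'I_(2 ^ b) | x %% 2 ^ k != c].
  by apply/setP => x; rewrite !inE.
have -> : 2 ^ b = 2 ^ (b - k) * 2 ^ k by rewrite -expnD subnK.
set N := #|_|; move: N (2 ^ (b - k)) (expn_gt0 2 k) => N q; case: (2 ^ k) => // K _ /=; nia.
Qed.

(** Bernoulli's inequality [(1 + 1/k)^m >= 1 + m/k] with denominators cleared. *)
Lemma bernoulli_nat k m : k ^ m * (k + m) <= k * k.+1 ^ m.
Proof.
elim: m => [|m IH]; first by rewrite !expn0; lia.
rewrite !expnS; move: IH; move: (k ^ m) (k.+1 ^ m) => u v; nia.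
Qed.

Lemma pred_expn_half K : 0 < K -> 2 * K.-1 ^ K <= K ^ K.
Proof.
case: K => // k _ /=; have := bernoulli_nat k k.+1.
case: k => [|k]; first by rewrite exp0n.
move: (_ ^ _) (_ ^ _) => u v; nia.
Qed.

Lemma leq_expl a b e : a <= b -> a ^ e <= b ^ e.
Proof. by case: e => // e ab; rewrite leq_exp2r. Qed.

Lemma pred_expn_bound K s y : 0 < K -> K * s <= y -> 2 ^ s * K.-1 ^ y <= K ^ y.
Proof.
move=> K0 /subnK <-; rewrite !expnD mulnCA leq_mul ?leq_expl ?leq_pred //.
by rewrite !expnM -expnMn leq_expl ?pred_expn_half.
Qed.

Section Colouring.
Variables (V : finType) (b : nat).
Definition colouring := {ffun V -> 'I_(2 ^ b)}.

(** Colours of different points are independent, so the event is a product set of probability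
    [(1 - 2^-k)^|Y|]. *)
Lemma card_avoid (Y : {set V}) k c s : k <= b -> c < 2 ^ k -> 2 ^ k * s <= #|Y| ->
  #|[set f : colouring | [forall y in Y, f y %% 2 ^ k != c]]| * 2 ^ s <= #|{: colouring}|.
Proof.
move=> kb ck sY; pose F (y : V) := [pred x : 'I_(2 ^ b) | (y \in Y) ==> (x %% 2 ^ k != c)].
have -> : #|[set f : colouring | [forall y in Y, f y %% 2 ^ k != c]]| = #|family F|.
  apply: eq_card => f; rewrite inE; apply/forallP/familyP => H y; exact: H.
have q0 : 0 < 2 ^ k by rewrite expn_gt0.
rewrite card_family foldrE big_map enumT -/(index_enum V).
have qE := card_modn_neq kb ck; set q := #|_| in qE.
have -> : \prod_y #|F y| = q ^ #|Y| * (2 ^ b) ^ #|~: Y|.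
  rewrite (bigID (mem Y)) /= -!prod_nat_const; congr (_ * _).
    by apply: eq_bigr => y yY; rewrite /q cardsE; apply: eq_card => x; rewrite !inE yY.
  rewrite (eq_bigl (mem (~: Y))); last by move=> y; rewrite /= inE.
  apply: eq_bigr => y; rewrite inE in_setC => /negbTE yY; rewrite -[RHS]card_ord.
  by apply: eq_card => x; rewrite !inE yY.
rewrite card_ffun card_ord -(cardsC Y) expnD mulnAC leq_mul2r; apply/orP; right.
rewrite -(@leq_pmul2r ((2 ^ k) ^ #|Y|)) ?expn_gt0 ?q0 // mulnAC -expnMn qE expnMn.
rewrite mulnAC [X in X <= _]mulnC [X in _ * X]mulnC leq_mul2l; apply/orP; right.
exact: pred_expn_bound.
Qed.

(** All colours [c] are covered because the surviving class is chosen only after the colouring is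
    known. *)
Lemma card_miss (I : finType) (Y : I -> {set V}) k s : k <= b ->
  #|[set f : colouring | [exists i, (2 ^ k * s <= #|Y i|) &&
      [exists c : 'I_(2 ^ k), [forall y in Y i, f y %% 2 ^ k != c]]]]| * 2 ^ s
  <= #|I| * 2 ^ k * #|{: colouring}|.
Proof.
move=> kb; have := @card_union_bound I _ (fun i (f : colouring) => (2 ^ k * s <= #|Y i|) &&
      [exists c : 'I_(2 ^ k), [forall y in Y i, f y %% 2 ^ k != c]]) s (2 ^ k) #|{: colouring}|.
apply => i; case: (leqP _ #|Y i|) => sY /=; last first.
  by rewrite (_ : [set f | _] = set0) ?cards0 //; apply/setP => f; rewrite !inE.
have := @card_union_bound 'I_(2 ^ k) _
  (fun c (f : colouring) => [forall y in Y i, f y %% 2 ^ k != c]) s 1 #|{: colouring}|.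
by rewrite card_ord muln1; apply => c; rewrite mul1n; apply: card_avoid.
Qed.

Definition cclass k (f : colouring) (X : {set V}) (c : nat) := [set x in X | f x %% 2 ^ k == c].

Lemma pow2_gt0 k : 0 < 2 ^ k. Proof. by rewrite expn_gt0. Qed.

Definition minclass k (f : colouring) (X : {set V}) : {set V} :=
  cclass k f X [arg min_(c < Ordinal (pow2_gt0 k)) #|cclass k f X c|].

Lemma minclass_sub k f X : minclass k f X \subset X.
Proof. by apply/subsetP => x; rewrite inE => /andP[]. Qed.

Lemma card_minclass k f X : #|minclass k f X| * 2 ^ k <= #|X|.
Proof.
have -> : #|X| = \sum_(c < 2 ^ k) #|cclass k f X c|.
  rewrite -sum1_card (partition_big (fun x => Ordinal (ltn_pmod (f x) (pow2_gt0 k))) predT) //=.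
  apply: eq_bigr => c _; rewrite -sum1_card; apply: eq_bigl => x.
  by rewrite inE -val_eqE.
rewrite mulnC -[2 ^ k in X in X <= _]card_ord -sum_nat_const; apply: leq_sum => c _.
by rewrite /minclass; case: arg_minnP => // c0 _; apply.
Qed.

Lemma minclass_hit k (f : colouring) (X Y : {set V}) : Y \subset X ->
  ~~ [exists c : 'I_(2 ^ k), [forall y in Y, f y %% 2 ^ k != c]] ->
  Y :&: minclass k f X != set0.
Proof.
move=> /subsetP YX; rewrite negb_exists /minclass; set c := [arg min_(_ < _) _].
move=> /forallP /(_ c); rewrite negb_forall => /existsP[y].
rewrite negb_imply negbK => /andP[yY yc].
by apply/set0Pn; exists y; rewrite !inE yY yc YX.
Qed.

(** * Nested random chains of vertex sets *)

Section Chain.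
Variable T : nat.

Fixpoint chain (f : {ffun 'I_T -> colouring}) (l : nat) : {set V} :=
  if l is l'.+1 then
    if insub l' is Some i then minclass 1 (f i) (chain f l') else set0
  else setT.

Lemma chainS f (l : 'I_T) : chain f l.+1 = minclass 1 (f l) (chain f l).
Proof. by rewrite /= valK. Qed.

(** The colouring [f r] is still fresh when level [r] is known; this permits conditioning through
    [card_history]. *)
Lemma chain_upd f (r : 'I_T) x l : l <= r -> chain (upd f r x) l = chain f l.
Proof.
elim: l => //= l IH lr; case: insubP => // i _ il; rewrite IH ?(ltnW lr) // ffunE.
by case: eqP => // ir; move: lr; rewrite -il ir ltnn.
Qed.

Lemma card_chain f l : #|chain f l| * 2 ^ l <= #|V|.
Proof.
elim: l => [|l IH]; first by rewrite cardsT muln1.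
rewrite [chain _ _]/=; case: insubP => [i _ _|_]; last by rewrite cards0.
by apply: leq_trans IH; rewrite expnS mulnA leq_mul2r -{1}(expn1 2) card_minclass orbT.
Qed.

Lemma chain_sub f l l' : l <= l' -> chain f l' \subset chain f l.
Proof.
move=> /subnK <-; elim: (_ - _) => // d IH; rewrite addSn [chain _ _.+1]/=.
by apply: subset_trans IH; case: insubP => [i _ _|_]; rewrite ?sub0set ?minclass_sub.
Qed.

Definition chain_good (I : finType) (Y : I -> {set V}) s f :=
  [forall i, [forall l : 'I_T, (2 * s <= #|Y i :&: chain f l|) ==>
     (Y i :&: chain f l.+1 != set0)]].

(** Given the earlier colourings, the sets [Y i :&: chain f l] are fixed, and [card_miss] applies
    with two colours. *)
Lemma card_chain_bad (I : finType) (Y : I -> {set V}) s : 0 < b ->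
  #|[set f | ~~ chain_good Y s f]| * 2 ^ s <=
  T * (#|I| * 2) * #|{ffun 'I_T -> colouring}|.
Proof.
move=> b0; pose bad (l : 'I_T) (f : {ffun 'I_T -> colouring}) := [exists i,
  (2 * s <= #|Y i :&: chain f l|) && (Y i :&: chain f l.+1 == set0)].
have -> : [set f | ~~ chain_good Y s f] = [set f | [exists l, bad l f]].
  apply/setP => f; rewrite !inE negb_forall; apply/existsP/existsP => [] [i].
    rewrite negb_forall => /existsP[l]; rewrite negb_imply negbK => H.
    by exists l; apply/existsP; exists i.
  case/existsP => l H; exists l; rewrite negb_forall; apply/existsP; exists i.
  by rewrite negb_imply negbK.
rewrite -[X in X * _ * _]card_ord; apply: card_history => [|l f].
  by apply/card_gt0P; exists [ffun=> Ordinal (pow2_gt0 b)].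
apply: leq_trans (card_miss (fun i => Y i :&: chain f l) (k := 1) s b0).
rewrite leq_mul2r; apply/orP; right; apply: subset_leq_card; apply/subsetP => x.
rewrite !inE => /existsP[i]; rewrite chainS chain_upd // ffunE eqxx => /andP[H1 H2].
apply/existsP; exists i; rewrite H1 /=; apply: contraTT H2 => H2.
have := minclass_hit (subsetIr (Y i) (chain f l)) H2.
by rewrite -setIA (setIidPr (minclass_sub _ _ _)).
Qed.

(** Level [T] is empty because sizes at least halve. The level just before the first empty one is
    nonempty, and goodness makes it small. *)
Lemma chain_last (I : finType) (Y : I -> {set V}) s f i : #|V| < 2 ^ T ->
  chain_good Y s f -> Y i != set0 ->
  exists l : 'I_T, [/\ 0 < #|Y i :&: chain f l|, #|Y i :&: chain f l| < 2 * s &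
    forall l', l < l' -> Y i :&: chain f l' = set0].
Proof.
move=> VT /forallP /(_ i) /forallP good Y0.
have T0 : chain f T = set0.
  apply/eqP; rewrite -cards_eq0 -leqn0 -ltnS -(ltn_pmul2r (pow2_gt0 T)) mul1n.
  exact: leq_ltn_trans (card_chain f T) VT.
have ex : exists l, Y i :&: chain f l == set0 by exists T; rewrite T0 setI0.
case: (ex_minnP ex) => -[|l] /eqP l0 lmin.
  by move: Y0; rewrite -[Y i]setIT l0 eqxx.
have lT : l < T by have := lmin T; rewrite T0 setI0 eqxx; apply.
have ln0 : Y i :&: chain f l != set0 by apply/negP => /lmin; rewrite ltnn.
exists (Ordinal lT) => /=; split.
- by rewrite card_gt0.
- by rewrite ltnNge; apply/negP => /(implyP (good (Ordinal lT))) /=; rewrite l0 eqxx.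
- move=> l' ll'; apply/eqP; rewrite -subset0 -l0; apply: setIS; exact: chain_sub.
Qed.
End Chain.
End Colouring.

(** * Sampling an edge between two vertex sets *)

Section Darts.
Variable n : nat.
Local Notation V := 'I_n.
Implicit Types (G : {set Edge n}) (d : V * V) (S Z : {set V}).

Definition joins (e : Edge n) d := (val e == d) || (val e == (d.2, d.1)).

Definition darts G : {set V * V} := \bigcup_(e in G) [set d | joins e d].

Lemma in_darts G d : (d \in darts G) = [exists e in G, joins e d].
Proof.
apply/bigcupP/existsP => [[e eG]|[e /andP[eG ed]]]; last by exists e; rewrite ?inE.
by rewrite inE => ed; exists e; apply/andP.
Qed.


Lemma joins_inj e e' d : joins e d -> joins e' d -> e = e'.
Proof.
move=> H H'; apply: val_inj; move: (valP e) (valP e') H H'; rewrite /joins.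
case: (val e) (val e') d => [x y] [x' y'] [u v] /= xy xy'; rewrite !xpair_eqE.
case/orP => /andP[/eqP E1 /eqP E2]; case/orP => /andP[/eqP E3 /eqP E4];
  by subst; rewrite // ltnNge ltnW in xy'.
Qed.

Lemma adj_darts G x y : adj G x y <-> (x, y) \in darts G.
Proof.
rewrite in_darts; split=> [[e eG H]|/existsP[e /andP[eG H]]].
  apply/existsP; exists e; rewrite eG /joins; case: H => -[<- <-]; rewrite ?eqxx //.
    by rewrite -surjective_pairing eqxx.
  by rewrite /= -surjective_pairing eqxx orbT.
exists e => //; case/orP: H => /eqP -> /=; by [left|right].
Qed.

Lemma darts_sym G x y : ((x, y) \in darts G) = ((y, x) \in darts G).
Proof.
by rewrite !in_darts; apply: eq_existsb => e; rewrite /joins /= orbC.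
Qed.

(** At most one edge joins a given pair, so membership of a dart is linear over the field with two
    elements. *)
Lemma mem_darts_parity G d : (d \in darts G) = parity (fun e => joins e d) G.
Proof.
rewrite in_darts; case: existsP => [[e /andP[eG ed]]|H]; last first.
  rewrite /parity big1 // => e eG; apply/negP => ed; apply: H; exists e; exact/andP.
rewrite /parity (bigD1 e) //= ed big1 // => e' /andP[_ ne].
by apply/negP => ed'; move: ne; rewrite (joins_inj ed ed') eqxx.
Qed.

(** The transpose of [darts]: it turns a parity over selected darts into a parity over edges, which
    the stream can maintain. *)
Definition dart_weight (P w : pred (V * V)) (e : Edge n) : bool :=
  \big[addb/false]_(d | P d && w d) joins e d.

Lemma dart_weightP P w G :
  parity (dart_weight P w) G = parity w [set d in darts G | P d].
Proof.
rewrite /parity /dart_weight exchange_big /=.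
rewrite (eq_bigr (fun d => d \in darts G)); last by move=> d _; rewrite mem_darts_parity.
rewrite big_mkcond [RHS]big_mkcond; apply: eq_bigr => d _; rewrite [in RHS]in_set.
by case: (P d); case: (w d); case: (d \in darts G).
Qed.

Lemma card_edges_of_darts (D : {set V * V}) :
  #|[set e : Edge n | [exists d in D, joins e d]]| <= #|D|.
Proof.
pose f d := [pick e : Edge n | joins e d].
have some_inj : injective (@Some (Edge n)) by move=> ? ? [].
rewrite -(card_imset _ some_inj); apply: leq_trans (leq_imset_card f D).
apply: subset_leq_card; apply/subsetP => _ /imsetP[e + ->].
rewrite inE => /existsP[d /andP[dD ed]]; apply/imsetP; exists d => //.
by rewrite /f; case: pickP => [e' /joins_inj -/(_ _ ed) ->|/(_ e)] //; rewrite ed.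
Qed.

Section Sampler.
Variables (T r tau : nat) (w : 'I_r -> V * V -> bool) (dec : {ffun 'I_r -> bool} -> {set V * V}).
Hypothesis decP : forall X : {set V * V}, #|X| <= tau -> dec [ffun i => parity (w i) X] = X.

Local Notation cell := ('I_T * 'I_T)%type.
Local Notation slot := ('I_T * 'I_T * 'I_r)%type.

Definition lex (x y : cell) := (x.1 < y.1) || ((x.1 == y.1) && (x.2 < y.2)).

Lemma lex_trichotomy x y : [\/ x = y, lex x y | lex y x].
Proof.
case: x y => [a b] [c d]; rewrite /lex /=.
have [ac|ca|/val_inj ->] := ltngtP a c; [by constructor 2| by constructor 3|].
rewrite eqxx /=; have [bd|db|/val_inj ->] := ltngtP b d; by [constructor 2| constructor 3|constructor 1].
Qed.

Definition sample (v : {ffun slot -> bool}) : option (V * V) :=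
  if [pick x : cell | [exists i, v (x, i)] &&
        [forall y : cell, lex x y ==> [forall i, ~~ v (y, i)]]] is Some x
  then [pick d in dec [ffun i => v (x, i)]] else None.

Variables (A B : nat -> {set V}).

Definition cell_darts G (S Z : {set V}) (x : cell) :=
  [set d in darts G | (d.1 \in S :&: B x.2) && (d.2 \in Z :&: A x.1)].

Definition slots G S Z : {ffun slot -> bool} :=
  [ffun x => parity (w x.2) (cell_darts G S Z x.1)].

(** The answer [None] has to be correct too, since it makes a supernode leave. *)
Definition sampled G (S Z : {set V}) (o : option (V * V)) : Prop :=
  if o is Some d then [/\ d \in darts G, d.1 \in S & d.2 \in Z]
  else forall d, d \in darts G -> d.1 \in S -> d.2 \in Z -> False.

Lemma slots0 G S Z x : cell_darts G S Z x = set0 -> forall i, ~~ slots G S Z (x, i).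
Proof. by move=> E i; rewrite ffunE /= E /parity big_set0. Qed.

Lemma slots_neq0 G S Z x : cell_darts G S Z x != set0 -> #|cell_darts G S Z x| <= tau ->
  exists i, slots G S Z (x, i).
Proof.
move=> F0 Ft; apply/existsP; apply: contraNT F0; rewrite negb_exists => /forallP H.
rewrite -(decP Ft); have -> : [ffun i => parity (w i) (cell_darts G S Z x)] =
  [ffun i => parity (w i) set0].
  by apply/ffunP => i; have := H i; rewrite !ffunE => /negbTE ->; rewrite /parity big_set0.
by rewrite decP ?cards0.
Qed.

(** The last nonempty cell is sparse, so its syndrome is nonzero, while all later cells have zero
    syndrome; hence the scan selects exactly this cell. *)
Lemma sampleP G S Z :
  ((exists2 d, d \in darts G & (d.1 \in S) && (d.2 \in Z)) -> exists x : cell,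
    [/\ cell_darts G S Z x != set0, #|cell_darts G S Z x| <= tau &
      forall y, lex x y -> cell_darts G S Z y = set0]) ->
  sampled G S Z (sample (slots G S Z)).
Proof.
move=> good; rewrite /sample; case: pickP => [x /andP[/existsP[i xi] /forallP later]|none].
  have xF : cell_darts G S Z x != set0.
    by apply: contraTneq xi => /slots0.
  have [z [zF zt zlater]] : exists x : cell,
    [/\ cell_darts G S Z x != set0, #|cell_darts G S Z x| <= tau &
      forall y, lex x y -> cell_darts G S Z y = set0].
    apply: good; case/set0Pn: xF => d; rewrite !inE => /andP[dG] /andP[/andP[d1 _] /andP[d2 _]].
    by exists d; rewrite ?inE // d1.
  have xz : x = z.
    have [//|xz|zx] := lex_trichotomy x z.
      have [i' zi'] := slots_neq0 zF zt.
      by have := later z; rewrite xz => /forallP /(_ i'); rewrite zi'.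
    by move: xF; rewrite (zlater _ zx) eqxx.
  subst z; have -> : [ffun i => slots G S Z (x, i)] = [ffun i => parity (w i) (cell_darts G S Z x)].
    by apply/ffunP => i'; rewrite !ffunE.
  rewrite decP //; case: pickP => [d|H] /=.
    by rewrite !inE => /andP[dG] /andP[/andP[? _] /andP[? _]].
  by case/set0Pn: xF => d; rewrite H.
move=> d dG dS dZ; have [|x [xF xt later]] := good; first by exists d => //; rewrite dS.
have := none x; have [i xi] := slots_neq0 xF xt.
have -> : [exists i, slots G S Z (x, i)] by apply/existsP; exists i.
move/negbT; rewrite /= negb_forall => /existsP[y]; rewrite negb_imply negb_forall.
by case/andP => /later E /existsP[i']; rewrite (slots0 E).
Qed.
End Sampler.

Definition reach G (S Z : {set V}) := [set y in Z | [exists x in S, (x, y) \in darts G]].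

(** First [Z] is thinned to fewer than [2 * s] endpoints, then their neighbours in [S]. Goodness of
    [fB] for every [j] covers whichever level the first chain ends at. *)
Lemma chains_cell T b s (fA fB : {ffun 'I_T -> colouring V b}) G (S Z : {set V}) :
  n < 2 ^ T ->
  chain_good (fun _ : unit => reach G S Z) s fA ->
  chain_good (fun j : 'I_T => reach G (Z :&: chain fA j) S) s fB ->
  (exists2 d, d \in darts G & (d.1 \in S) && (d.2 \in Z)) -> exists x : 'I_T * 'I_T,
    let C := cell_darts (chain fA) (chain fB) G S Z in
    [/\ C x != set0, #|C x| <= (2 * s) ^ 2 & forall y, lex x y -> C y = set0].
Proof.
move=> nT gA gB [[x y] xyG /= /andP[xS yZ]].
have VT : #|{: V}| < 2 ^ T by rewrite card_ord.
have Y0 : reach G S Z != set0.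
  by apply/set0Pn; exists y; rewrite inE yZ; apply/existsP; exists x; rewrite xS.
have [j [j1 j2 j3]] := chain_last VT gA (i := tt) Y0.
have X0 : reach G (Z :&: chain fA j) S != set0.
  case/card_gt0P: j1 => y'; rewrite !inE => /andP[/andP[y'Z /existsP[x' /andP[x'S xy']]] y'j].
  apply/set0Pn; exists x'; rewrite inE x'S; apply/existsP; exists y'.
  by rewrite inE y'Z y'j darts_sym.
have [l [l1 l2 l3]] := chain_last VT gB X0.
have sub (k m : 'I_T) : cell_darts (chain fA) (chain fB) G S Z (k, m) \subset
    setX (reach G (Z :&: chain fA k) S :&: chain fB m) (reach G S Z :&: chain fA k).
  apply/subsetP => -[u v]; rewrite !inE /= => /andP[uv] /andP[/andP[uS um] /andP[vZ vk]].
  rewrite uS um vZ vk !andbT /=; apply/andP; split; apply/existsP.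
    by exists v; rewrite !inE vZ vk darts_sym uv.
  by exists u; rewrite uS uv.
exists (j, l); split.
- case/card_gt0P: l1 => x'; rewrite !inE => /andP[/andP[x'S /existsP[y']]].
  rewrite !inE => /andP[/andP[y'Z y'j] yx] x'l; apply/set0Pn; exists (x', y').
  by rewrite !inE darts_sym yx x'S x'l y'Z y'j.
- apply: leq_trans (subset_leq_card (sub _ _)) _; rewrite cardsX -mulnn leq_mul // ltnW //.
(* A later cell has either no endpoint left in [Z] or, on the same level [j], no neighbour left in
   [S]. *)
- move=> [k m]; rewrite /lex /= => /orP[jk|/andP[/eqP jk lm]]; apply/eqP;
    rewrite -subset0; apply: subset_trans (sub _ _) _; apply/subsetP => -[u v]; rewrite in_setX /=.
    by rewrite j3 // !inE andbF.
  by rewrite -jk l3 // !inE.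
Qed.
End Darts.

(** * One pass of the clustering *)

Lemma chain_good_comp T (V : finType) b (I J : finType) (g : J -> I) (Y : I -> {set V}) s
    (f : {ffun 'I_T -> colouring V b}) :
  chain_good Y s f -> chain_good (fun j => Y (g j)) s f.
Proof. by move=> /forallP H; apply/forallP => j; apply: (H (g j)). Qed.

Lemma leq_card_bigcup (I T : finType) (P : pred I) (F : I -> {set T}) m :
  (forall i, P i -> #|F i| <= m) -> #|\bigcup_(i | P i) F i| <= #|P| * m.
Proof.
move=> H; rewrite -sum_nat_const; apply: (big_rec2 (fun (X : {set T}) k => #|X| <= k)).
  by rewrite cards0.
move=> i X k Pi Xk; apply: leq_trans (leq_card_setU _ _) _; apply: leq_add => //; exact: H.
Qed.

Section Clusters.
Variable n : nat.
Local Notation V := 'I_n.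
Implicit Types (G H : {set Edge n}) (sup cl : {ffun V -> option V}).

(* Vertex [x] lies in the supernode labelled [sup x], and the supernode [a] in
   the cluster with centre [cl a]; [None] stands for a vertex, respectively a
   supernode, that has left the clustering. *)
Definition clus sup cl (x : V) : option V := obind cl (sup x).
Definition cluster sup cl c := [set x | clus sup cl x == Some c].
Definition centers sup cl := [set c | [exists x, clus sup cl x == Some c]].
Definition labels sup := [set a | [exists x, sup x == Some a]].
Definition block sup a := [set x | sup x == Some a].

Definition target sup cl (Q : {set V}) (z : option V) :=
  if z is Some c then cluster sup cl c
  else [set x | if clus sup cl x is Some c then c \in Q else false].

Definition nbr G sup cl a := [set c | reach G (block sup a) (cluster sup cl c) != set0].

(** The deterministic interface between sampling and the distance analysis. In [spec_some] a
    supernode stays, joins a surviving cluster, or leaves after securing an edge to each adjacent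
    cluster. *)
Record pass_spec G (Q : {set V}) sup cl H m cl' H' : Prop := PassSpec {
  spec_sub : H \subset H';
  spec_sup : H' \subset H :|: G;
  spec_card : #|H'| <= #|H| + #|labels sup| * m;
  spec_none : forall a, cl a = None -> cl' a = None;
  spec_some : forall a c, cl a = Some c ->
    [\/ c \in Q /\ cl' a = Some c,
        exists x y c', [/\ sup x = Some a, clus sup cl y = Some c', c' \in Q,
                          (x, y) \in darts H' & cl' a = Some c'] |
        cl' a = None /\ forall x y c', sup x = Some a -> (x, y) \in darts G ->
          clus sup cl y = Some c' ->
          exists x' y', [/\ sup x' = Some a, clus sup cl y' = Some c' & (x', y') \in darts H'] ] }.

Section Update.
Variables (sup cl : {ffun V -> option V}) (Q : {set V}) (H : {set Edge n}).
Variables (RQ : V -> option (V * V)) (RC : V -> V -> option (V * V)).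

Definition waiting a := if cl a is Some c then c \notin Q else false.

Definition new_cl : {ffun V -> option V} :=
  [ffun a => if cl a is Some c then
      if c \in Q then Some c else if RQ a is Some d then clus sup cl d.2 else None
    else None].

Definition new_darts a : {set V * V} :=
  if RQ a is Some d then [set d] else [set d | [exists c, RC a c == Some d]].

Definition new_H := H :|:
  [set e | [exists d in \bigcup_(a | waiting a && (a \in labels sup)) new_darts a, joins e d]].

Lemma darts_new_H G d a : waiting a -> a \in labels sup ->
  d \in new_darts a -> d \in darts G -> d \in darts new_H.
Proof.
move=> wa la dn; rewrite !in_darts => /existsP[e /andP[eG ed]]; apply/existsP; exists e.
rewrite ed andbT !inE; apply/orP; right; apply/existsP; exists d; rewrite ed andbT.
by apply/bigcupP; exists a; rewrite ?wa.
Qed.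

Lemma pass_specP G m : 0 < m ->
  (forall a, m <= #|nbr G sup cl a| -> nbr G sup cl a :&: Q != set0) ->
  (forall a, sampled G (block sup a) (target sup cl Q None) (RQ a)) ->
  (forall a c, #|nbr G sup cl a| <= m ->
     sampled G (block sup a) (target sup cl Q (Some c)) (RC a c)) ->
  pass_spec G Q sup cl H m new_cl new_H.
Proof.
move=> m0 hit sQ sC.
(* A supernode that finds no surviving neighbour has fewer than [m] adjacent clusters, so its
   answers [RC] can be trusted. *)
have small a : RQ a = None -> #|nbr G sup cl a| < m.
  move=> E; rewrite ltnNge; apply/negP => /hit /set0Pn[c].
  rewrite !inE => /andP[/set0Pn[y]]; rewrite !inE => /andP[yc /existsP[x /andP[xa xy]]] cQ.
  rewrite inE in xa; have := sQ a; rewrite E => /(_ (x, y) xy); apply; rewrite !inE //=.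
  by rewrite (eqP yc).
have dG a d : d \in new_darts a -> d \in darts G.
  rewrite /new_darts; have := sQ a; case E: (RQ a) => [d'|].
    by case=> d'G _ _; rewrite inE => /eqP ->.
  move=> _; rewrite inE => /existsP[c /eqP Ec].
  by have := sC a c (ltnW (small a E)); rewrite Ec => -[].
split.
- exact: subsetUl.
- apply: setUS; apply/subsetP => e; rewrite inE => /existsP[d /andP[/bigcupP[a _ /dG]]].
  by rewrite in_darts => /existsP[e' /andP[e'G e'd]] ed; rewrite (joins_inj ed e'd).
(* A waiting supernode adds one edge if it joins, and otherwise at most one per adjacent cluster. *)
- apply: leq_trans (leq_card_setU _ _) _; rewrite leq_add2l.
  apply: leq_trans (card_edges_of_darts _) _.
  apply: leq_trans (leq_card_bigcup (m := m) _) _ => [a _|].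
    rewrite /new_darts; case E: (RQ a) => [d|]; first by rewrite cards1.
    apply: leq_trans (ltnW (small a E)); rewrite -(card_imset _ (fun x y (e : Some x = Some y) => Some_inj e)).
    apply: leq_trans (leq_imset_card (RC a) _); apply: subset_leq_card.
    apply/subsetP => _ /imsetP[d + ->]; rewrite inE => /existsP[c /eqP Ec].
    apply/imsetP; exists c => //; rewrite inE; apply/set0Pn; exists d.2.
    have := sC a c (ltnW (small a E)); rewrite Ec => -[dg da dc]; rewrite inE dc.
    by apply/existsP; exists d.1; rewrite da -surjective_pairing.
  rewrite leq_mul2r; apply/orP; right; apply: subset_leq_card.
  by apply/subsetP => a /andP[].  
- by move=> a E; rewrite ffunE E.
move=> a c E; rewrite ffunE E; case: ifPn => cQ; first by constructor 1.
have wa : waiting a by rewrite /waiting E.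
have sa := sQ a; case Ea: (RQ a) sa => [d|] sa.
  case: sa => dg; rewrite !inE; case Ed: (clus _ _ d.2) => [c'|//] /eqP d1 c'Q.
  constructor 2; exists d.1, d.2, c'; split => //; rewrite -surjective_pairing.
  apply: (@darts_new_H G d a wa) => //.
    by rewrite inE; apply/existsP; exists d.1; rewrite d1.
  by rewrite /new_darts Ea inE.
constructor 3; split=> // x y c' xa xy yc'.
have := sC a c' (ltnW (small a Ea)); case Ec: (RC a c') => [d|].
  case=> dg; rewrite !inE => /eqP d1 /eqP d2; exists d.1, d.2; split=> //.
  rewrite -surjective_pairing; apply: (@darts_new_H G d a wa) => //.
    by rewrite inE; apply/existsP; exists d.1; rewrite d1.
  by rewrite /new_darts Ea inE; apply/existsP; exists c'; rewrite Ec.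
by move/(_ (x, y) xy); rewrite !inE /= xa yc' !eqxx => /(_ isT) /(_ isT).
Qed.
End Update.

(** * Randomness, sketch and decoding of one pass *)

Section Seeds.
Variables (T b kappa s : nat).
Hypothesis nT : n < 2 ^ T.

Definition pass_seed : finType :=
  (colouring V b * ({ffun 'I_T -> colouring V b} * {ffun 'I_T -> colouring V b}))%type.

Definition sampled_centers sup cl (ps : pass_seed) := minclass kappa ps.1 (centers sup cl).

Definition outer_reach G sup cl ps (i : V * option V) :=
  reach G (block sup i.1) (target sup cl (sampled_centers sup cl ps) i.2).

Definition inner_reach G sup cl (ps : pass_seed) (i : V * option V * 'I_T) :=
  reach G (target sup cl (sampled_centers sup cl ps) i.1.2 :&: chain ps.2.1 i.2)
    (block sup i.1.1).

Definition pass_good G sup cl (ps : pass_seed) :=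
  [&& [forall a, (2 ^ kappa * s <= #|nbr G sup cl a|) ==>
         (nbr G sup cl a :&: sampled_centers sup cl ps != set0)],
      chain_good (outer_reach G sup cl ps) s ps.2.1 &
      chain_good (inner_reach G sup cl ps) s ps.2.2].

Lemma nbr_centers G sup cl a : nbr G sup cl a \subset centers sup cl.
Proof.
apply/subsetP => c; rewrite !inE => /set0Pn[y]; rewrite !inE => /andP[yc _].
by apply/existsP; exists y.
Qed.

(** Three draws in succession, each analysed given the previous ones: centre colours, chain on the
    target side, chain on the supernode side. *)
Lemma card_pass_bad G sup cl : 0 < b -> kappa <= b ->
  #|[set ps | ~~ pass_good G sup cl ps]| * 2 ^ s <=
  (n * 2 ^ kappa + (T * (n * n.+1 * 2) + T * (n * n.+1 * T * 2))) * #|{: pass_seed}|.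
Proof.
move=> b0 kb.
pose P (f : colouring V b) := [exists a, (2 ^ kappa * s <= #|nbr G sup cl a|) &&
   [exists c : 'I_(2 ^ kappa), [forall y in nbr G sup cl a, f y %% 2 ^ kappa != c]]].
(* [outer_reach] reads only the centre colours and [inner_reach] also the first chain; the other
   seed components are filled in arbitrarily. *)
pose QA (f : colouring V b) (fA : {ffun 'I_T -> colouring V b}) :=
  ~~ chain_good (outer_reach G sup cl (f, (fA, fA))) s fA.
pose QB f fA (fB : {ffun 'I_T -> colouring V b}) :=
  ~~ chain_good (inner_reach G sup cl (f, (fA, fA))) s fB.
have HB f fA : #|[set x | QB f fA x]| * 2 ^ s <= T * (n * n.+1 * T * 2) * #|{ffun 'I_T -> colouring V b}|.
  have := card_chain_bad T (inner_reach G sup cl (f, (fA, fA))) s b0.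
  by rewrite !card_prod card_option !card_ord.
have HA f : #|[set x | QA f x]| * 2 ^ s <= T * (n * n.+1 * 2) * #|{ffun 'I_T -> colouring V b}|.
  have := card_chain_bad T (outer_reach G sup cl (f, ([ffun=> f], [ffun=> f]))) s b0.
  by rewrite !card_prod card_option !card_ord.
have HP : #|[set f | P f]| * 2 ^ s <= n * 2 ^ kappa * #|colouring V b|.
  by have := card_miss (nbr G sup cl) s kb; rewrite card_ord.
have HAB f := card_pair_bad (HA f) (HB f).
apply: leq_trans (card_pair_bad HP HAB); rewrite leq_mul2r; apply/orP; right.
apply: subset_leq_card; apply/subsetP => -[f [fA fB]]; rewrite !inE /pass_good /=.
rewrite !negb_and -/(QA f fA) -/(QB f fA fB) => /orP[H|->]; last by rewrite orbT.
apply/orP; left; apply: contraNT H; rewrite negb_exists => /forallP H.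
apply/forallP => a; apply/implyP => big; have := H a; rewrite big /=.
exact: minclass_hit (nbr_centers G sup cl a).
Qed.

Variables (r : nat) (w : 'I_r -> V * V -> bool) (dec : {ffun 'I_r -> bool} -> {set V * V}).
Hypothesis decP : forall X : {set V * V}, #|X| <= (2 * s) ^ 2 -> dec [ffun i => parity (w i) X] = X.
Variables (r' : nat) (w' : 'I_r' -> V -> bool) (dec' : {ffun 'I_r' -> bool} -> {set V}).
Hypothesis decP' : forall X : {set V}, #|X| <= 2 ^ kappa * s -> dec' [ffun i => parity (w' i) X] = X.
Hypothesis s0 : 0 < s.

Local Notation slot := ('I_T * 'I_T * 'I_r)%type.
Local Notation register := (V * (slot + slot * 'I_r'))%type.

Lemma sampled_good G sup cl ps a z : pass_good G sup cl ps ->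
  sampled G (block sup a) (target sup cl (sampled_centers sup cl ps) z)
    (sample dec (slots T w (chain ps.2.1) (chain ps.2.2) G (block sup a)
       (target sup cl (sampled_centers sup cl ps) z))).
Proof.
case/and3P => _ gA gB; apply: (sampleP decP) => H.
have := chains_cell nT (chain_good_comp (fun _ : unit => (a, z)) gA)
  (chain_good_comp (fun j : 'I_T => (a, z, j)) gB) H.
by [].
Qed.

Definition slot_weight sup cl ps a z (x : slot) : Edge n -> bool :=
  dart_weight (fun d => (d.1 \in block sup a :&: chain ps.2.2 x.1.2) &&
    (d.2 \in target sup cl (sampled_centers sup cl ps) z :&: chain ps.2.1 x.1.1)) (w x.2).

(** For a fixed slot, the answers towards single clusters form a bit vector indexed by centres;
    [inr (x, k)] is its [k]-th syndrome bit in the second code. *)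
Definition index_weight sup cl ps (i : register) (e : Edge n) : bool :=
  match i.2 with
  | inl x => slot_weight sup cl ps i.1 None x e
  | inr (x, k) => \big[addb/false]_(c | w' k c) slot_weight sup cl ps i.1 (Some c) x e
  end.

(* Hence only the registers of [labels sup] have to be kept. *)
Lemma index_weight0 sup cl ps i e : i.1 \notin labels sup -> index_weight sup cl ps i e = false.
Proof.
move=> la; have E z x : slot_weight sup cl ps i.1 z x e = false.
  rewrite /slot_weight /dart_weight big1 // => d /andP[/andP[]].
  rewrite !inE => /andP[da _]; case/negP: la; rewrite inE.
  by apply/existsP; exists d.1.
by rewrite /index_weight; case: i.2 => [x|[x k]]; rewrite ?big1.
Qed.

Definition pass_decode sup cl H ps (u : {ffun register -> bool}) :=
  let RQ a := sample dec [ffun x => u (a, inl x)] in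
  let RC a c := sample dec [ffun x => c \in dec' [ffun k => u (a, inr (x, k))]] in
  (new_cl sup cl (sampled_centers sup cl ps) RQ,
   new_H sup cl (sampled_centers sup cl ps) H RQ RC).

Lemma pass_decodeP G sup cl H ps : pass_good G sup cl ps ->
  let z := pass_decode sup cl H ps [ffun i => parity (index_weight sup cl ps i) G] in
  pass_spec G (sampled_centers sup cl ps) sup cl H (2 ^ kappa * s) z.1 z.2.
Proof.
move=> good z; apply: pass_specP.
- by rewrite muln_gt0 s0 expn_gt0.
- by case/andP: good => /forallP H0 _ a; apply/implyP.
- move=> a; have := sampled_good a None good; set v := slots _ _ _ _ _ _ _.
  have -> // : v = [ffun x => [ffun i => parity (index_weight sup cl ps i) G] (a, inl x)].
  by apply/ffunP => x; rewrite !ffunE -dart_weightP.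
move=> a c small; have := sampled_good a (Some c) good; set v := slots _ _ _ _ _ _ _.
set v' := [ffun x => _]; have -> // : v = v'.
apply/ffunP => x; rewrite [RHS]ffunE.
pose vx c := slots T w (chain ps.2.1) (chain ps.2.2) G (block sup a)
       (target sup cl (sampled_centers sup cl ps) (Some c)) x.
(* Exchanging the sums identifies the stored bits with the syndrome of the set of centres whose slot
   is one. *)
have -> : [ffun k => [ffun i => parity (index_weight sup cl ps i) G] (a, inr (x, k))] =
    [ffun k => parity (w' k) [set c | vx c]].
  apply/ffunP => k; rewrite !ffunE {1}/parity exchange_big /=.
  rewrite /parity big_mkcond [RHS]big_mkcond; apply: eq_bigr => c' _ /=.
  rewrite inE /vx ffunE -dart_weightP -/(parity _ _).
  by case: (w' k c'); case: (parity _ _).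
(* Only adjacent clusters have nonempty cells, so this set is within the range of the decoder. *)
rewrite decP' ?inE //; apply: leq_trans small; apply: subset_leq_card; apply/subsetP => c'.
rewrite !inE => vc; have : cell_darts (T := T) (chain ps.2.1) (chain ps.2.2) G (block sup a)
   (cluster sup cl c') x.1 != set0.
  by apply: contraTneq vc => E; rewrite /vx ffunE E /parity big_set0.
case/set0Pn => d; rewrite 4!inE => /andP[dG /andP[/andP[da _]]].
rewrite inE => /andP[dc _]; apply/set0Pn; exists d.2; rewrite !inE dc.
by apply/existsP; exists d.1; rewrite inE da -surjective_pairing.
Qed.

(** Registers outside [D] are identically zero; the others are packed by their position in
    [enum D]. *)
Lemma compress (I : finType) (D : {set I}) (W : I -> Edge n -> bool) B :
  (forall i e, i \notin D -> W i e = false) -> #|D| <= B ->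
  exists (W' : 'I_B -> Edge n -> bool) (ext : {ffun 'I_B -> bool} -> {ffun I -> bool}),
    forall G, ext (sketch W' G) = [ffun i => parity (W i) G].
Proof.
move=> W0 DB; pose pos i := index i (enum D).
exists (fun k e => if onth (enum D) k is Some i then W i e else false).
exists (fun u => [ffun i => (i \in D) && (if insub (pos i) is Some k then u k else false)]).
move=> G; apply/ffunP => i; rewrite !ffunE; case: (boolP (i \in D)) => iD /=; last first.
  by rewrite /parity big1 // => e _; apply: W0.
have pi : pos i < size (enum D) by rewrite index_mem mem_enum.
have pB : pos i < B by apply: leq_trans DB; rewrite cardE.
rewrite insubT ffunE /=; rewrite onthE (nth_map i) // nth_index ?mem_enum //.
Qed.

Lemma pass_recover sup cl H ps B :
  #|labels sup| * (T * T * r * r'.+1) <= B ->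
  exists (W : 'I_B -> Edge n -> bool)
    (rec : {ffun 'I_B -> bool} -> {ffun V -> option V} * {set Edge n}),
  forall G, pass_good G sup cl ps ->
    pass_spec G (sampled_centers sup cl ps) sup cl H (2 ^ kappa * s)
      (rec (sketch W G)).1 (rec (sketch W G)).2.
Proof.
move=> DB; pose D := setX (labels sup) [set: slot + slot * 'I_r'].
have [||W [ext extP]] := @compress _ D (index_weight sup cl ps) B.
- by move=> [a x] e la; apply: index_weight0; move: la; rewrite in_setX in_setT andbT.
- apply: leq_trans DB; rewrite cardsX cardsT card_sum !card_prod !card_ord leq_mul2l.
  by rewrite mulnS leqnn orbT.
exists W; exists (fun u => pass_decode sup cl H ps (ext u)) => G good.
by rewrite extP; apply: pass_decodeP.
Qed.
End Seeds.
End Clusters.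

(** * Distances in the spanner *)

Section Walks.
Variable n : nat.
Implicit Types (G H : {set Edge n}) (u v x y z : 'I_n).

Lemma walk_cat H k l u v z : walk H k u v -> walk H l v z -> walk H (k + l) u z.
Proof.
elim: k u => [|k IH] u /=; first by move=> ->.
by case=> y [uy yv] vz; exists y; split; last exact: IH.
Qed.

Lemma adj_sym H u v : adj H u v -> adj H v u.
Proof. by case=> e eH E; exists e => //; case: E; [right|left]. Qed.

Lemma walk_sym H k u v : walk H k u v -> walk H k v u.
Proof.
elim: k u v => [|k IH] u v; first by move=> ->.
case=> y [/adj_sym uy /IH yv]; rewrite -addn1.
apply: walk_cat yv _; by exists u.
Qed.

Lemma walk_mono H H' k u v : H \subset H' -> walk H k u v -> walk H' k u v.
Proof.
move=> /subsetP HH; elim: k u => [|k IH] u //= [y [[e eH E] /IH]].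
by exists y; split => //; exists e => //; apply: HH.
Qed.

Definition within H k u v := exists2 k', k' <= k & walk H k' u v.

Lemma within_refl H k u : within H k u u. Proof. by exists 0. Qed.

Lemma within_trans H k l v u z : within H k u v -> within H l v z -> within H (k + l) u z.
Proof.
case=> k' kk uv [l' ll vz]; exists (k' + l'); first exact: leq_add.
exact: walk_cat uv vz.
Qed.

Lemma within_sym H k u v : within H k u v -> within H k v u.
Proof. by case=> k' kk /walk_sym uv; exists k'. Qed.

Lemma within_mono H H' k l u v : H \subset H' -> k <= l -> within H k u v -> within H' l u v.
Proof. by move=> HH kl [k' kk /(walk_mono HH) uv]; exists k' => //; apply: leq_trans kl. Qed.

Lemma within_dart H x y : (x, y) \in darts H -> within H 1 x y.
Proof. by move/adj_darts => xy; exists 1 => //; exists y. Qed.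

Lemma spanner_of_edges G H t :
  (forall x y, (x, y) \in darts G -> within H t x y) ->
  forall u v d, walk G d u v -> exists d', d' <= t * d /\ walk H d' u v.
Proof.
move=> Ht u v d; elim: d u => [|d IH] u /=; first by move=> ->; exists 0.
case=> y [/adj_darts /Ht [k kt uy] /IH [d' [dd yv]]]; exists (k + d').
by split; [rewrite mulnS leq_add | apply: walk_cat uy yv].
Qed.

(* Every supernode has radius [r] and every cluster radius [R] around its
   centre: joining through one edge costs one edge plus the diameter of the
   supernode. *)
Section Radius.
Variables (G : {set Edge n}) (Q : {set 'I_n}) (sup cl : {ffun 'I_n -> option 'I_n}).
Variables (H : {set Edge n}) (m : nat) (cl' : {ffun 'I_n -> option 'I_n}) (H' : {set Edge n}).
Variables (r R : nat).
Hypothesis spec : pass_spec G Q sup cl H m cl' H'.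
Hypothesis Hr : forall x a, sup x = Some a -> within H r a x.
Hypothesis HR : forall x c, clus sup cl x = Some c -> within H R c x.

Lemma block_diameter a x y : sup x = Some a -> sup y = Some a -> within H' (r + r) x y.
Proof.
move=> xa ya; apply: (@within_trans _ _ _ a).
  by apply/within_sym/(within_mono (spec_sub spec) (leqnn r))/Hr.
exact/(within_mono (spec_sub spec) (leqnn r))/Hr.
Qed.

Lemma pass_radius x c : clus sup cl' x = Some c -> within H' (R + (r + r).+1) c x.
Proof.
rewrite /clus; case xa: (sup x) => [a|] //= xc.
case Ea: (cl a) => [c0|]; last by rewrite (spec_none spec Ea) in xc.
have HR' y c' : clus sup cl y = Some c' -> within H' R c' y.
  by move=> /HR; apply: within_mono (spec_sub spec) (leqnn R).
case: (spec_some spec Ea) => [[_]|[x' [y' [c' [xa' yc' _ xy]]]]|[]].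
- rewrite xc => -[->]; apply: (within_mono (subxx _) (leq_addr _ R)).
  by apply: HR'; rewrite /clus xa.
- rewrite xc => -[->]; apply: (within_trans (HR' _ _ yc')).
  rewrite -add1n; apply: (@within_trans _ _ _ x').
    by apply/within_sym/within_dart.
  exact: block_diameter xa.
- by rewrite xc.
Qed.

Lemma pass_centers : centers sup cl' \subset Q.
Proof.
apply/subsetP => c; rewrite inE => /existsP[x /eqP]; rewrite /clus.
case xa: (sup x) => [a|] //= xc.
case Ea: (cl a) => [c0|]; last by rewrite (spec_none spec Ea) in xc.
case: (spec_some spec Ea) => [[cQ]|[x' [y' [c' [_ _ cQ _]]]]|[]]; rewrite xc => // -[->] //.
Qed.

(** The detour crosses the supernode of [x], takes the edge kept to the cluster of [y], and reaches
    [y] through its centre. *)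
Lemma pass_leave x y : (x, y) \in darts G -> clus sup cl x -> clus sup cl y ->
  clus sup cl' x = None -> within H' ((r + r).+1 + (R + R)) x y.
Proof.
move=> xy; rewrite {1 3}/clus; case xa: (sup x) => [a|] //=.
case Ea: (cl a) => [c0|] // _; case yc: (clus sup cl y) => [c|] // _ xN.
case: (spec_some spec Ea) => [[_]|[x' [y' [c' [_ _ _ _]]]]|[_]]; rewrite ?xN //.
move/(_ x y c xa xy yc) => [x' [y' [xa' yc' xy']]].
rewrite addSnnS; apply: (within_trans (block_diameter xa xa')); rewrite -add1n.
apply: (within_trans (within_dart xy')); apply: (@within_trans _ _ _ c).
  by apply/within_sym/(within_mono (spec_sub spec) (leqnn R))/HR.
exact/(within_mono (spec_sub spec) (leqnn R))/HR.
Qed.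

Lemma pass_edge t x y : (r + r).+1 + (R + R) <= t -> (x, y) \in darts G ->
  (clus sup cl x /\ clus sup cl y) \/ within H t x y ->
  (clus sup cl' x /\ clus sup cl' y) \/ within H' t x y.
Proof.
move=> rt xy [[cx cy]|]; last by right; apply: within_mono (spec_sub spec) (leqnn t) _.
case Ex: (clus sup cl' x) => [c|]; last first.
  by right; apply: within_mono (subxx _) rt _; apply: pass_leave.
case Ey: (clus sup cl' y) => [c'|]; first by left.
right; apply: within_mono (subxx _) rt _; apply: within_sym.
by apply: pass_leave => //; rewrite -darts_sym.
Qed.
End Radius.
End Walks.

Lemma foldl_enum_ind p (St : Type) (F : St -> 'I_p -> St) st0 (P : nat -> St -> Prop) :
  P 0 st0 ->
  (forall i : 'I_p, P i (foldl F st0 (take i (enum 'I_p))) ->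
     P i.+1 (F (foldl F st0 (take i (enum 'I_p))) i)) ->
  P p (foldl F st0 (enum 'I_p)).
Proof.
move=> P0 PS; suff H k : k <= p -> P k (foldl F st0 (take k (enum 'I_p))).
  by have := H p (leqnn p); rewrite take_oversize // size_enum_ord.
elim: k => [|k IH] kp; first by rewrite take0.
have -> : take k.+1 (enum 'I_p) = rcons (take k (enum 'I_p)) (Ordinal kp).
  rewrite (take_nth (Ordinal kp)) ?size_enum_ord //; congr rcons.
  by apply: val_inj; rewrite /= nth_enum_ord.
by rewrite -cats1 foldl_cat /=; apply: (PS (Ordinal kp)); apply: IH; apply: ltnW.
Qed.

Lemma mem_take_enum p (i j : 'I_p) k : j \in take k (enum 'I_p) -> j < k.
Proof.
move=> jk; have : nat_of_ord j \in map val (take k (enum 'I_p)) by apply: map_f.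
by rewrite map_take val_enum_ord take_iota mem_iota add0n => /andP[_]; rewrite leq_min => /andP[].
Qed.

(** * The whole algorithm *)

(** The flag and the seeds each fail with probability at most [2^-(f+1)]. *)
Lemma union_bound_flag x y f u a b :
  x <= 2 ^ (u + a + b) + y * 2 ^ (f.+1 + a + b) -> y * 2 ^ f.+1 <= 2 ^ u ->
  x * 2 ^ f <= 2 ^ (f.+1 + u + a + b).
Proof.
move=> xy yu; have {}yu : y * 2 ^ (f.+1 + a + b) <= 2 ^ (u + a + b).
  by rewrite -!(addnA _ a) !(expnD _ _ (a + b)) mulnA leq_mul.
apply: leq_trans (leq_mul (leq_trans xy (leq_add (leqnn _) yu)) (leqnn _)) _.
by rewrite addnn -mul2n -expnS -expnD leq_exp2l //; lia.
Qed.

Section MachineFailure.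
Variables (n p a b f rho s M : nat) (PS St : finType) (st0 : St).
Variable W : 'I_p -> PS -> St -> 'I_b -> Edge n -> bool.
Variable next : 'I_p -> PS -> St -> {ffun 'I_b -> bool} -> St.
Variable out : St -> {set Edge n}.
Variable good : {set Edge n} -> 'I_p -> St -> pred PS.
Hypothesis cardPS : #|PS| = 2 ^ rho.
Hypothesis cardSt : #|St| <= 2 ^ a.
Hypothesis card_bad : forall G i st, #|[set ps | ~~ good G i st ps]| * 2 ^ s <= M * #|PS|.

Definition state_at (G : {set Edge n}) seed (i : nat) :=
  foldl (ideal_pass W next G seed) st0 (take i (enum 'I_p)).

(** The seed of pass [i] is independent of the state before that pass, as [card_history]
    requires. *)
Lemma state_at_upd G seed (i : 'I_p) x : state_at G (upd seed i x) i = state_at G seed i.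
Proof.
rewrite /state_at; have : forall j, j \in take i (enum 'I_p) -> j < i.
  by move=> j; apply: mem_take_enum.
elim: (take _ _) (st0) => //= j l IH st H; rewrite IH; last first.
  by move=> k kl; apply: H; rewrite inE kl orbT.
congr foldl; rewrite /ideal_pass ffunE; case: eqP => // ji.
by have := H j (mem_head _ _); rewrite ji ltnn.
Qed.

Lemma linear_stream_alg_fail : p * M * 2 ^ f.+1 <= 2 ^ s ->
  exists A : stream_alg n (f.+1 + p * rho + a + b) p,
  forall str, valid_stream str -> forall Pr : {set Edge n} -> Prop,
  (forall seed, (forall i, good (graph_of str) i (state_at (graph_of str) seed i) (seed i)) ->
     Pr (out (ideal_run st0 W next seed (graph_of str)))) ->
  nfail Pr A str * 2 ^ f <= 2 ^ (f.+1 + p * rho + a + b).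
Proof.
move=> ps; have [A AP] := linear_stream_alg f.+1 st0 W next out cardPS cardSt.
exists A => str vs Pr ok; set G := graph_of str in ok.
pose bad (i : 'I_p) seed := ~~ good G i (state_at G seed i) (seed i).
apply: union_bound_flag (AP str vs Pr) _; rewrite -/G.
apply: (@leq_trans (#|[set seed | [exists i, bad i seed]]| * 2 ^ f.+1)).
  rewrite leq_mul2r; apply/orP; right; apply: subset_leq_card; apply/subsetP => seed.
  rewrite !inE; apply: contraR; rewrite negb_exists => /forallP H; apply/asboolP/ok => i.
  by have := H i; rewrite negbK.
rewrite -(leq_pmul2r (expn_gt0 2 s)) mulnAC.
apply: leq_trans (leq_mul _ (leqnn (2 ^ f.+1))) _.
  apply: (@card_history _ _ bad s M) => [|i seed]; first by rewrite cardPS expn_gt0.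
  rewrite (_ : [set x | _] = [set ps | ~~ good G i (state_at G seed i) ps]) //.
  by apply/setP => x; rewrite !inE /bad state_at_upd updE.
rewrite card_ffun !card_ord cardPS -expnM (mulnC rho) mulnAC mulnC leq_mul2l.
by rewrite ps orbT.
Qed.
End MachineFailure.

(** * All passes together, for an abstract schedule [c] *)

Section Assembly.
Variables (n L d g W : nat) (c : nat -> nat).
Local Notation V := 'I_n.
Local Notation p := (g * d).+1.
Local Notation q := (d.*2.+1).
Local Notation s := (12 * L).
Hypothesis L0 : 0 < L.
Hypothesis nL : n < 2 ^ L.
Hypothesis d0 : 0 < d.
Hypothesis pL : p <= 2 ^ (4 * L).
Hypothesis c0 : c 0 = 0.
Hypothesis c_le : forall j, c j <= c j.+1.
Hypothesis c_max : forall j, c j <= L.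
Hypothesis c_end : n < 2 ^ c p.
Hypothesis cW : forall j N, j < p -> N * 2 ^ c (j %/ d * d) <= n -> N * 2 ^ (c j.+1 - c j) <= W.

Let kappa j := c j.+1 - c j.
Let stretch := 2 * q ^ g - 1.
Let hmax := p * (W * s).

(* Radius after [t] passes of phase [i]: twice it plus one is [q^i (2t+1)]. *)
Definition rad i t := (q ^ i * t.*2.+1)./2.

Lemma radE i t : (rad i t).*2.+1 = q ^ i * t.*2.+1.
Proof.
rewrite -[RHS]odd_double_half oddM oddX /= !odd_double /= orbT //.
Qed.

Lemma radS i t : rad i t.+1 = rad i t + (rad i 0 + rad i 0).+1.
Proof.
have := radE i t.+1; have := radE i t; have := radE i 0.
rewrite doubleS; move: (rad _ _) (rad _ _) (rad _ _) (q ^ i) => x y z u; nia.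
Qed.

Lemma rad_phase i : rad i d = rad i.+1 0.
Proof. by rewrite /rad expnSr muln1. Qed.

Lemma rad_succ j : rad (j.+1 %/ d) (j.+1 %% d) = rad (j %/ d) (j %% d).+1.
Proof.
have jE : j.+1 = j %/ d * d + (j %% d).+1 by rewrite addnS -divn_eq.
have := ltn_pmod j d0; rewrite leq_eqVlt => /orP[/eqP E|jd].
  have -> : j.+1 %% d = 0 by rewrite jE E modnMDl modnn.
  by rewrite E rad_phase jE E divnMDl // divnn d0 addn1.
have -> : j.+1 %% d = (j %% d).+1 by rewrite jE modnMDl (modn_small jd).
by have -> : j.+1 %/ d = j %/ d by rewrite jE divnMDl // (divn_small jd) addn0.
Qed.

(** With [i = j %/ d] and [t = j %% d] the left side is [2 q^i (t + 1) - 1]. Inside a phase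
    [t + 1 <= d < q]; in the last pass [i = g] and [t = 0], which gives equality. *)
Lemma rad_stretch j : j < p ->
  (rad (j %/ d) 0 + rad (j %/ d) 0).+1 + (rad (j %/ d) (j %% d) + rad (j %/ d) (j %% d)) <= stretch.
Proof.
move=> jp; rewrite /stretch.
have := radE (j %/ d) (j %% d); have := radE (j %/ d) 0.
have : q ^ (j %/ d) * (j %% d).+1 <= q ^ g.
  have [jg|jg] := ltnP j (g * d).
    have ig : (j %/ d).+1 <= g by rewrite ltn_divLR.
    apply: leq_trans (leq_pexp2l _ ig) => //; rewrite expnSr leq_mul2l; apply/orP; right.
    by have := ltn_pmod j d0; lia.
  have -> : j = g * d by lia.
  by rewrite mulnK // modnMl muln1.
move: (rad _ _) (rad _ _) (q ^ _) (q ^ g) => x y u v; nia.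
Qed.

(** The invariant after [j] passes. At a phase boundary the supernodes are about to be replaced, so
    the claims about them are made only under [mid]. *)
Record state_ok (G : {set Edge n}) (mid : bool) j (sup cl : {ffun V -> option V}) (H : {set Edge n}) : Prop :=
  StateOk {
    ok_sub : H \subset G;
    ok_card : #|H| <= j * (W * s);
    ok_block : mid -> forall x a, sup x = Some a -> within H (rad (j %/ d) 0) a x;
    ok_labels : mid -> #|labels sup| * 2 ^ c (j %/ d * d) <= n;
    ok_cluster : forall x a, clus sup cl x = Some a -> within H (rad (j %/ d) (j %% d)) a x;
    ok_edge : forall x y, (x, y) \in darts G ->
      (clus sup cl x /\ clus sup cl y) \/ within H stretch x y;
    ok_centers : #|centers sup cl| * 2 ^ c j <= n }.

Definition idmap : {ffun V -> option V} := [ffun a => Some a].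

Definition contract j (sup cl : {ffun V -> option V}) :=
  if d %| j then ([ffun x => clus sup cl x], idmap) else (sup, cl).

Lemma state_ok0 G : state_ok G false 0 idmap idmap set0.
Proof.
have E x : clus idmap idmap x = Some x by rewrite /clus ffunE /= ffunE.
split=> //.
- exact: sub0set.
- by rewrite cards0.
- move=> x a; rewrite E => -[->]; apply: within_mono (subxx _) (leq0n _) _; exact: within_refl.
- by move=> x y _; left; rewrite !E.
- by rewrite c0 muln1 -[X in _ <= X]card_ord max_card.
Qed.

Lemma contract_ok G j sup cl H : state_ok G (~~ (d %| j)) j sup cl H ->
  let z := contract j sup cl in state_ok G true j z.1 z.2 H.
Proof.
rewrite /contract; case: ifPn => dj /= ok; last first.
  by case: ok => *; split; auto.
have E x : clus [ffun x => clus sup cl x] idmap x = clus sup cl x.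
  by rewrite {1}/clus ffunE; case: (clus sup cl x) => //= a; rewrite ffunE.
have j0 : j %% d = 0 by apply/eqP.
case: ok => h1 h2 _ _ h5 h6 h7; split => //.
- by move=> _ x a; rewrite ffunE => /h5; rewrite j0.
- move=> _; rewrite divnK // (_ : labels _ = centers sup cl) //.
  by apply/setP => a; rewrite !inE; apply: eq_existsb => x; rewrite ffunE.
- by move=> x a; rewrite E; apply: h5.
- by move=> x y; rewrite !E; apply: h6.
- rewrite (_ : centers _ _ = centers sup cl) //.
  by apply/setP => a; rewrite !inE; apply: eq_existsb => x; rewrite E.
Qed.

Lemma pass_ok G (Q : {set V}) j sup cl H cl' H' : j < p -> state_ok G true j sup cl H ->
  pass_spec G Q sup cl H (2 ^ kappa j * s) cl' H' ->
  #|Q| * 2 ^ kappa j <= #|centers sup cl| ->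
  state_ok G (~~ (d %| j.+1)) j.+1 sup cl' H'.
Proof.
move=> jp [h1 h2 h3 h4 h5 h6 h7] spec Qk; move/(_ isT): h3 => h3; move/(_ isT): h4 => h4.
have divS : ~~ (d %| j.+1) -> j.+1 %/ d = j %/ d.
  by rewrite divnS // => /negbTE ->; rewrite add0n.
split.
- by apply: subset_trans (spec_sup spec) _; rewrite subUset h1 subxx.
- apply: leq_trans (spec_card spec) _; rewrite mulSn addnC leq_add // mulnA leq_mul2r.
  by apply/orP; right; apply: cW.
- move=> /divS -> x a /h3; exact: within_mono (spec_sub spec) (leqnn _).
- by move=> /divS ->.
- by move=> x a xa; rewrite rad_succ radS; apply: (pass_radius spec h3 h5 xa).
- move=> x y xy; apply: (pass_edge spec h3 h5 (rad_stretch jp) xy); exact: h6.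
- apply: leq_trans h7; have -> : c j.+1 = kappa j + c j by rewrite subnK.
  rewrite expnD mulnA leq_mul2r; apply/orP; right; apply: leq_trans Qk.
  by rewrite leq_mul2r; apply/orP; right; apply/subset_leq_card/(pass_centers spec).
Qed.

(** Fewer than one centre is left, so every vertex has left and every edge of [G] is spanned. *)
Lemma final_ok G mid sup cl H : state_ok G mid p sup cl H ->
  is_spanner G H (Posz stretch) /\ #|H| <= hmax.
Proof.
case=> h1 h2 _ _ _ h6 h7; split => //; split => // u v k walkG.
have none x : clus sup cl x = None.
  case E: (clus sup cl x) => [a|] //; move: h7; rewrite leqNgt => /negP[].
  apply: leq_trans c_end _; rewrite leq_pmull // card_gt0; apply/set0Pn.
  by exists a; rewrite inE; apply/existsP; exists x; rewrite E.
have [x y xy|k' [kk' walkH]] := @spanner_of_edges n G H stretch _ u v k walkG.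
  by have := h6 x y xy; rewrite !none => -[[]|].
by exists k'; split => //; rewrite -PoszM lez_nat.
Qed.

Local Notation St := ({ffun V -> option V} * {ffun V -> option V} *
  {H : {set Edge n} | #|H| <= hmax})%type.
Local Notation PS := (pass_seed n L L).

Let nS : n.+1 <= 2 ^ L. Proof. exact: nL. Qed.

Lemma card_pass_seed : #|{: PS}| = 2 ^ (L * n * (1 + 2 * L)).
Proof.
rewrite !card_prod !card_ffun !card_ord -!expnM -!expnD; congr (2 ^ _); nia.
Qed.

Lemma card_edges : #|{: Edge n}|.+1 <= 2 ^ (2 * L).
Proof.
apply: (@leq_trans (n.+1 ^ 2)); last by rewrite mulnC expnM leq_exp2r.
rewrite card_sig -mulnn; apply: (@leq_trans (n * n).+1); last by lia.
by rewrite ltnS; apply: leq_trans (max_card _) _; rewrite card_prod card_ord.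
Qed.

Lemma card_state : #|{: St}| <= 2 ^ (2 * L * n + 2 * L * hmax).
Proof.
have E1 : #|{ffun V -> option V}| <= 2 ^ (L * n).
  by rewrite card_ffun card_option card_ord expnM leq_expl.
have E2 : #|{: {H : {set Edge n} | #|H| <= hmax}}| <= 2 ^ (2 * L * hmax).
  apply: (@leq_trans (#|{: Edge n}|.+1 ^ hmax)); last by rewrite expnM leq_expl ?card_edges.
  by rewrite card_sig; apply: leq_trans (card_small_sets _ _); apply: subset_leq_card; apply/subsetP => X; rewrite !inE.
rewrite !card_prod expnD leq_mul //.
by rewrite -mulnA mul2n -addnn expnD leq_mul.
Qed.

(** [r] is the code length for [(2 * s) ^ 2] darts out of fewer than [2 ^ (2 * L)]. In [B], the
    factor [(2 * L * s + 2) * W] absorbs the second code and the number of supernodes. *)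
Let r := (2 * L * (2 * ((2 * s) ^ 2))).+1.
Let B := L * L * r * (2 * L * s + 2) * W.

Lemma pass_program j sup cl H (ps : PS) : j < p ->
  exists z : ('I_B -> Edge n -> bool) * ({ffun 'I_B -> bool} -> {ffun V -> option V} * {set Edge n}),
  forall G, #|labels sup| * 2 ^ kappa j <= W -> pass_good (kappa j) s G sup cl ps ->
    pass_spec G (sampled_centers (kappa j) sup cl ps) sup cl H (2 ^ kappa j * s)
      (z.2 (sketch z.1 G)).1 (z.2 (sketch z.1 G)).2.
Proof.
move=> jp; case: (leqP (#|labels sup| * 2 ^ kappa j) W) => lW; last first.
  (* With too many supernodes nothing is promised, and any program will do. *)
  by exists ((fun _ _ => false), (fun=> (cl, H))).
have s0 : 0 < s by rewrite muln_gt0.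
have [w [dec decP]] : exists (w : 'I_r -> V * V -> bool) dec,
    forall X : {set V * V}, #|X| <= (2 * s) ^ 2 -> dec [ffun i => parity (w i) X] = X.
  apply: sparse_decoder; rewrite card_prod card_ord /r addnn -mul2n.
  apply: (@leq_ltn_trans ((2 ^ (2 * L)) ^ (2 * (2 * s) ^ 2))); last first.
    by rewrite -expnM ltn_exp2l.
  apply: leq_expl; rewrite mulnC expnM; apply: (@leq_trans (n.+1 ^ 2)); last by rewrite leq_exp2r.
  by rewrite -mulnn; lia.
pose r' := (L * (2 * (2 ^ kappa j * s))).+1.
have [w' [dec' decP']] : exists (w' : 'I_r' -> V -> bool) dec',
    forall X : {set V}, #|X| <= 2 ^ kappa j * s -> dec' [ffun i => parity (w' i) X] = X.
  apply: sparse_decoder; rewrite card_ord addnn -mul2n.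
  by rewrite (leq_ltn_trans (leq_expl _ nS)) // -expnM ltn_exp2l.
have [|z1 [z2 zP]] := @pass_recover n L L (kappa j) s nL r w dec decP r' w' dec' decP' s0 sup cl H ps B.
  rewrite /B -!mulnA mulnCA leq_mul2l; apply/orP; right.
  rewrite mulnCA leq_mul2l; apply/orP; right; rewrite mulnCA leq_mul2l; apply/orP; right.
  apply: leq_trans (leq_mul (leqnn _) lW); rewrite mulnCA mulnC (mulnC #|_|) mulnA leq_mul2r.
  apply/orP; right; rewrite /r'; have := expn_gt0 2 (kappa j); move: (2 ^ _) => K /= K0.
  nia.
by exists (z1, z2) => G _; apply: zP.
Qed.

Lemma fail_count_bound kj : kj <= L ->
  n * 2 ^ kj + (L * (n * n.+1 * 2) + L * (n * n.+1 * L * 2)) <= 2 ^ (4 * L + 2).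
Proof.
move=> kL; have kK : 2 ^ kj <= 2 ^ L by rewrite leq_exp2l.
have LK : L < 2 ^ L by apply: ltn_expl.
rewrite expnD (mulnC 4) expnM; move: (2 ^ kj) (2 ^ L) nL kK LK => k K nK kK LK /=.
have -> : 2 ^ 2 = 4 by [].
have h1 : n * n.+1 <= K * K by apply: leq_mul => //; apply: ltnW.
have h2 : n * k <= K * K by apply: leq_mul => //; apply: ltnW.
have h3 : L * (n * n.+1) <= K * (K * K) by apply: leq_mul => //; apply: ltnW.
have h4 : L * (L * (n * n.+1)) <= K * (K * (K * K)) by apply: leq_mul => //; apply: ltnW.
have K1 : 2 <= K by lia.
have -> : K ^ 4 = K * (K * (K * K)) by rewrite !expnS expn0 muln1.
have e1 : K * K <= K * (K * K) by rewrite leq_pmull //; lia.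
have e2 : 2 * (K * (K * K)) <= K * (K * (K * K)) by rewrite leq_mul2r K1 orbT.
move: h1 h2 h3 h4 e1 e2; move: (K * (K * (K * K))) (K * (K * K)) (K * K) => K4 K3 K2.
nia.
Qed.

Let H0 : {H : {set Edge n} | #|H| <= hmax}.
Proof. by exists set0; rewrite cards0. Defined.

Theorem spanner_stream_alg : exists A : stream_alg n (L.+1 + p * (L * n * (1 + 2 * L)) +
    (2 * L * n + 2 * L * hmax) + B) p,
  forall str, valid_stream str ->
  nfail (fun H => is_spanner (graph_of str) H (Posz stretch) /\ #|H| <= hmax) A str * 2 ^ L
    <= 2 ^ (L.+1 + p * (L * n * (1 + 2 * L)) + (2 * L * n + 2 * L * hmax) + B).
Proof.
pose pre (j : nat) (st : St) := contract j st.1.1 st.1.2.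
have /choice [z zP] : forall x : 'I_p * PS * St, exists z :
    ('I_B -> Edge n -> bool) * ({ffun 'I_B -> bool} -> {ffun V -> option V} * {set Edge n}),
    let j := x.1.1 in let: (sup, cl) := pre j x.2 in
  forall G, #|labels sup| * 2 ^ kappa j <= W -> pass_good (kappa j) s G sup cl x.1.2 ->
    pass_spec G (sampled_centers (kappa j) sup cl x.1.2) sup cl (val x.2.2) (2 ^ kappa j * s)
      (z.2 (sketch z.1 G)).1 (z.2 (sketch z.1 G)).2.
  move=> [[j ps] st] /=; case: (pre j st) => sup cl.
  exact: pass_program.
pose W' i ps st := (z (i, ps, st)).1.
(* The default [H0] is taken only if the edge bound fails, which good passes exclude. *)
pose next (i : 'I_p) (ps : PS) (st : St) u : St :=
  let w := (z (i, ps, st)).2 u in ((pre i st).1, w.1, insubd H0 w.2).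
pose good G (i : 'I_p) (st : St) (ps : PS) := pass_good (kappa i) s G (pre i st).1 (pre i st).2 ps.
have card_bad G i st : #|[set ps | ~~ good G i st ps]| * 2 ^ s <= 2 ^ (4 * L + 2) * #|PS|.
  have kL : kappa i <= L by apply: leq_trans (leq_subr _ _) (c_max _).
  apply: leq_trans (leq_mul (fail_count_bound kL) (leqnn _)).
  exact: (card_pass_bad L s G (pre i st).1 (pre i st).2 L0 kL).
(* The exponents add up to [4L + (4L + 2) + (L + 1) = 9L + 3], at most [12L]. *)
have room : p * 2 ^ (4 * L + 2) * 2 ^ L.+1 <= 2 ^ s.
  rewrite -mulnA -expnD; apply: leq_trans (leq_mul pL (leqnn _)) _.
  by rewrite -expnD leq_exp2l //; lia.
have [A AP] := linear_stream_alg_fail (idmap, idmap, H0) W' next (fun st => val st.2)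
  card_pass_seed card_state card_bad room.
exists A => str vs; apply: AP => // seed ok; set G := graph_of str in ok *.
pose st1 := ideal_run (idmap, idmap, H0) W' next seed G.
apply: (@final_ok G (~~ (d %| p)) st1.1.1 st1.1.2).
apply: (@foldl_enum_ind p St _ _ (fun j st => state_ok G (~~ (d %| j)) j st.1.1 st.1.2 (val st.2))).
  by rewrite dvdn0; apply: state_ok0.
move=> i; have := ok i; rewrite /state_at; set st := foldl _ _ _ => /= gi /contract_ok.
have := zP (i, seed i, st) => /=; move: gi.
rewrite /good /ideal_pass /next /W' /=; rewrite -/(pre i st).
case: (pre i st) => sup cl /= gi spec oki.
have lW : #|labels sup| * 2 ^ kappa i <= W by apply: cW => //; apply: (ok_labels oki).
have ok' := pass_ok (ltn_ord i) oki (spec G lW gi) (card_minclass _ _ _).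
rewrite insubdK //.
by apply: leq_trans (ok_card ok') _; rewrite leq_mul2r; apply/orP; right; apply: ltn_ord.
Qed.
End Assembly.

(** * The schedule of the passes *)

Local Open Scope ring_scope.

Section RealBounds.
Variable R : realType.
Implicit Types x y : R.

Lemma ln2_gt0 : 0 < ln (2 : R).
Proof. by apply: ln_gt0; lra. Qed.

Lemma powR_log2 x : 0 < x -> powR 2 (log2 x) = x.
Proof.
move=> x0; have l0 := ln2_gt0; rewrite /powR /log2 gt_eqF //.
by rewrite mulfVK ?gt_eqF // lnK.
Qed.

Lemma powR2_le x y : (powR 2 x <= powR 2 y) = (x <= y).
Proof.
have l0 := ln2_gt0; rewrite -[LHS]ler_ln ?posrE ?powR_gt0 //.
by rewrite !ln_powR ler_pM2r.
Qed.

Lemma powR2_nat j : powR (2 : R) j%:R = (2 ^ j)%:R.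
Proof. by rewrite powR_mulrn // natrX. Qed.

Definition ceiln x : nat := `|Num.ceil x|%N.

Lemma ceiln_itv x : 0 <= x -> x <= (ceiln x)%:R < x + 1.
Proof.
move=> x0; have c0 : 0 <= Num.ceil x by rewrite ceil_ge0; lra.
have := ceil_itv x; rewrite /ceiln natr_absz ger0_norm // intrD => /andP[h1 h2].
by rewrite h2 /=; move: h1; rewrite mulrNz; lra.
Qed.

Lemma ceiln_mono x y : 0 <= x -> x <= y -> (ceiln x <= ceiln y)%N.
Proof.
move=> x0 xy; have /andP[_ h1] := ceiln_itv x0.
have /andP[h2 _] := ceiln_itv (le_trans x0 xy).
by rewrite -ltnS -(ltr_nat R) -natr1; lra.
Qed.

Section Schedule.
Variables (n L d g : nat) (k y lg : R).
Hypothesis n0 : (0 < n)%N.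
Hypothesis lgE : powR 2 lg = n%:R.
Hypothesis nL : (n < 2 ^ L)%N.
Hypothesis Ln : (2 ^ L <= 2 * n)%N.
Hypothesis d0 : (0 < d)%N.
Hypothesis y0 : 0 <= y.
Hypothesis ky : k * y = lg.
Hypothesis kmu : (k + 1) / 2 <= (d.+1 ^ g)%:R.

(* After [j] passes at most [n ^ (1 - expo j / k)] centres are to survive. *)
Definition expo j : nat := (d.+1 ^ (j %/ d) * (j %% d).+1 - 1)%N.

(** The target exponents are rounded up and capped at [L]; the final pass jumps to [L], so that no
    centre survives. *)
Definition sched j : nat := if (j <= g * d)%N then minn L (ceiln ((expo j)%:R * y)) else L.

(** Phase [i] starts with about [n^(1 - ((d+1)^i - 1)/k)] supernodes, so thinning the centres by
    [n^((d+1)^i/k)] costs [n^(1 + 1/k)] edges. *)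
Lemma expoS j : expo j.+1 = (expo j + d.+1 ^ (j %/ d))%N.
Proof.
have jE : j.+1 = (j %/ d * d + (j %% d).+1)%N by rewrite addnS -divn_eq.
have := expn_gt0 d.+1 (j %/ d); rewrite /expo.
have := ltn_pmod j d0; rewrite leq_eqVlt => /orP[/eqP E|jd].
  rewrite jE E modnMDl modnn divnMDl // divnn d0 addn1 expnSr.
  by move: (expn _ _) => u; clear -d0; nia.
have -> : (j.+1 %% d = (j %% d).+1)%N by rewrite jE modnMDl (modn_small jd).
have -> : (j.+1 %/ d = j %/ d)%N by rewrite jE divnMDl // (divn_small jd) addn0.
by move: (expn _ _) (modn _ _) => u e; clear; nia.
Qed.

Lemma expo_phase i : expo (i * d) = (d.+1 ^ i - 1)%N.
Proof. by rewrite /expo mulnK // modnMl muln1. Qed.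

Lemma expoy_ge0 j : 0 <= (expo j)%:R * y. Proof. by rewrite mulr_ge0. Qed.

Lemma sched0 : sched 0 = 0%N.
Proof. by rewrite /sched leq0n /expo div0n mod0n /= mul0r /ceiln ceil0 minn0. Qed.

Lemma sched_max j : (sched j <= L)%N.
Proof. by rewrite /sched; case: ifP => // _; apply: geq_minl. Qed.

Lemma sched_le j : (sched j <= sched j.+1)%N.
Proof.
rewrite {2}/sched; case: ifPn => jg; last exact: sched_max.
rewrite /sched (ltnW jg) leq_min geq_minl /=; apply: leq_trans (geq_minr _ _) _.
by apply: ceiln_mono; rewrite ?expoy_ge0 // ler_wpM2r // ler_nat expoS leq_addr.
Qed.

Lemma sched_end : (n < 2 ^ sched (g * d).+1)%N.
Proof. by rewrite /sched ltnn. Qed.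

Lemma sched_diff j : (j <= g * d)%N -> (sched (j %/ d * d) < L)%N ->
  (sched j.+1 - sched j)%:R - (sched (j %/ d * d))%:R <= 1 + y.
Proof.
move=> jg; set c0 := sched (_ * d).
have ig : (j %/ d * d <= g * d)%N by apply: leq_trans (leq_divM _ _) jg.
rewrite /c0 /sched ig gtn_min ltnn /= => cL.
have -> : minn L (ceiln ((expo (j %/ d * d))%:R * y)) = ceiln ((expo (j %/ d * d))%:R * y).
  by apply/minn_idPr/ltnW.
have /andP[+ _] := ceiln_itv (expoy_ge0 (j %/ d * d)).
rewrite {1}expo_phase natrB ?expn_gt0 // mulrBl mul1r; set c := (ceiln _)%:R => hc.
(* In the final pass the left side is [L - 2c], where [L <= lg + 1] and
   [2 (d+1)^g y >= (k + 1) y = lg + y]. In other passes rounding up costs less than one. *)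
have [jg1|jg1] : j = (g * d)%N \/ (j < g * d)%N by lia.
  rewrite jg jg1 ltnn.
  have jgd : (j %/ d = g)%N by rewrite jg1 mulnK.
  move: hc; rewrite jgd => hc.
  have cE : c = (ceiln ((expo (g * d))%:R * y))%:R by rewrite /c jgd.
  have -> : minn L (ceiln ((expo (g * d))%:R * y)) = ceiln ((expo (g * d))%:R * y).
    by apply/minn_idPr; rewrite -jgd ltnW.
  rewrite natrB; last by rewrite -jgd ltnW.
  rewrite -cE {cE}.
  have hL : L%:R <= lg + 1.
    rewrite -powR2_le powRD ?powR2_nat ?lgE ?powRr1 //; last by rewrite pnatr_eq0 implybT.
    by rewrite -natrM ler_nat mulnC.
  have : (k + 1) / 2 * y <= (d.+1 ^ g)%:R * y by rewrite ler_wpM2r.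
  by rewrite mulrAC mulrDl ky mul1r; lra.
rewrite jg jg1.
have mono : (ceiln ((expo j)%:R * y) <= ceiln ((expo j.+1)%:R * y))%N.
  by apply: ceiln_mono; rewrite ?expoy_ge0 // ler_wpM2r // ler_nat expoS leq_addr.
have /andP[_ h1] := ceiln_itv (expoy_ge0 j.+1).
have /andP[h2 _] := ceiln_itv (expoy_ge0 j).
have h3 : (expo j.+1)%:R * y = (expo j)%:R * y + (d.+1 ^ (j %/ d))%:R * y.
  by rewrite expoS natrD mulrDl.
have h4 : (minn L (ceiln ((expo j.+1)%:R * y)) - minn L (ceiln ((expo j)%:R * y)))%:R
    <= (ceiln ((expo j.+1)%:R * y))%:R - (ceiln ((expo j)%:R * y))%:R :> R.
  by rewrite -natrB // ler_nat; lia.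
lra.
Qed.

Lemma sched_space j N : (j < (g * d).+1)%N -> (N * 2 ^ sched (j %/ d * d) <= n)%N ->
  (N * 2 ^ (sched j.+1 - sched j) <= Num.truncn (2 * powR 2 (lg + y)))%N.
Proof.
rewrite ltnS => jg; case: N => [|N]; first by rewrite mul0n.
set N1 := N.+1; set c0 := sched (_ * d); set D := (_ - _)%N => Nn.
(* A nonempty set of supernodes shows that the cap was not reached at the start of the phase. *)
have cL : (c0 < L)%N.
  rewrite -(ltn_exp2l _ _ (isT : (1 < 2)%N)); apply: leq_ltn_trans nL.
  by apply: leq_trans Nn; rewrite leq_pmull.
have Dc := sched_diff jg cL; rewrite -/c0 -/D in Dc.
rewrite truncn_ge_nat ?mulr_ge0 ?powR_ge0 //.
have p0 : 0 < (2 ^ c0)%:R :> R by rewrite ltr0n expn_gt0.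
rewrite -(ler_pM2r p0) -natrM mulnAC natrM.
have E2 : (2 : R) * powR 2 (lg + y) * (2 ^ c0)%:R = powR 2 (1 + (lg + y) + c0%:R).
  by rewrite !powRD ?powRr1 ?powR2_nat ?pnatr_eq0 ?implybT ?ler0n //.
rewrite E2; apply: (@le_trans _ _ (n%:R * (2 ^ D)%:R)).
  by apply: ler_pM => //; rewrite ?ler_nat.
rewrite -lgE -powR2_nat -powRD ?pnatr_eq0 ?implybT // powR2_le; lra.
Qed.
End Schedule.
End RealBounds.

(** * The theorem *)

Lemma space_poly : exists K : nat, forall n L p W : nat, (0 < L)%N -> (0 < n)%N ->
  (p <= 2 * (L * L))%N ->
  (L.+1 + p * (L * n * (1 + 2 * L)) + (2 * L * n + 2 * L * (p * (W * (12 * L)))) +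
    L * L * (2 * L * (2 * ((2 * (12 * L)) ^ 2))).+1 * (2 * L * (12 * L) + 2) * W
   <= K * (L ^ 7 * (n + W)))%N.
Proof.
(* The sketch contributes [2500 * 26 = 650 * 100]; the coefficients [2], [6], [2], [48] of the other
   terms fit into the remaining [100]. *)
exists (651 * 100)%N => n L p W L0 n0 pL.
have h0 i : (i <= 7 -> L ^ i <= L ^ 7)%N by move=> i7; rewrite leq_pexp2l.
have h1 : (L.+1 <= 2 * (L ^ 7 * n))%N.
  apply: (@leq_trans (2 * (L ^ 7 * 1)))%N; last by rewrite !leq_mul.
  by have := h0 1%N isT; rewrite expn1; lia.
have h4 : (L * L * (L * L) <= L ^ 7)%N by have := h0 4%N isT; rewrite !expnS expn0 muln1 !mulnA.
have h4' a z : (a * (L * L * (L * L) * z) <= a * (L ^ 7 * z))%N.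
  by rewrite leq_mul2l leq_mul2r h4 !orbT.
have h2 : (p * (L * n * (1 + 2 * L)) <= 6 * (L ^ 7 * n))%N.
  apply: (@leq_trans (2 * (L * L) * (L * n * (3 * L))))%N.
    by rewrite !leq_mul //; lia.
  have -> : (2 * (L * L) * (L * n * (3 * L)) = 6 * (L * L * (L * L) * n))%N by lia.
  exact: h4'.
have h3 : (2 * L * n <= 2 * (L ^ 7 * n))%N.
  by rewrite -mulnA !leq_mul //; have := h0 1%N isT; rewrite expn1.
have h5 : (2 * L * (p * (W * (12 * L))) <= 48 * (L ^ 7 * W))%N.
  apply: (@leq_trans (2 * L * (2 * (L * L) * (W * (12 * L)))))%N; first by rewrite !leq_mul.
  have -> : (2 * L * (2 * (L * L) * (W * (12 * L))) = 48 * (L * L * (L * L) * W))%N by lia.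
  exact: h4'.
have h6 : (L * L * (2 * L * (2 * ((2 * (12 * L)) ^ 2))).+1 * (2 * L * (12 * L) + 2) * W
    <= 650 * 100 * (L ^ 7 * W))%N.
  have r1 : ((2 * L * (2 * ((2 * (12 * L)) ^ 2))).+1 <= 2500 * (L * L * L))%N.
    have : (0 < L * L * L)%N by rewrite !muln_gt0 L0.
    by rewrite !expnS expn0; lia.
  have r2 : (2 * L * (12 * L) + 2 <= 26 * (L * L))%N.
    by have : (0 < L * L)%N; [rewrite !muln_gt0 L0 | lia].
  apply: (@leq_trans (L * L * (2500 * (L * L * L)) * (26 * (L * L)) * W))%N.
    by apply: leq_mul => //; apply: leq_mul => //; rewrite leq_mul2l r1 orbT.
  have -> : (L ^ 7 = L * L * (L * L * L) * (L * L))%N by rewrite !expnS expn0; lia.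
  move: (L * L)%N => x; lia.
rewrite (mulnDr (L ^ 7)%N); apply: leq_trans (leq_add (leq_add (leq_add h1 h2) (leq_add h3 h5)) h6) _.
move: (L ^ 7 * n)%N (L ^ 7 * W)%N => x y; lia.
Qed.

Lemma succ_sqr_bounds q L : (0 < L)%N -> (q <= L * L)%N ->
  (q.+1 <= 2 * (L * L))%N /\ (q.+1 <= 2 ^ (4 * L))%N.
Proof.
move=> L0 qL; have qL2 : (q.+1 <= 2 * (L * L))%N.
  by have : (0 < L * L)%N; [rewrite muln_gt0 L0 | lia].
split=> //; apply: (leq_trans qL2); have LK : (L.+1 <= 2 ^ L)%N by apply: ltn_expl.
apply: (@leq_trans (2 ^ L * (2 ^ L * 2 ^ L)))%N.
  by apply: leq_mul; [lia | apply: leq_mul; apply: ltnW].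
by rewrite -!expnD leq_exp2l //; lia.
Qed.

(** * Consequences of the ranges of [k] and [g] *)

Section PassCount.
Variables (R : realType) (n g : nat) (k : R).
Hypothesis k1 : 1 <= k.
Hypothesis kn : k <= log2 (n%:R : R).
Hypothesis g1 : (1 <= g)%N.
Hypothesis gk : (g%:R : R) <= log2 k.
Local Notation m := (Num.ceil (powR ((k + 1) / 2) (g%:R^-1))).
Local Notation d := (`|m|.-1)%N.
Local Notation lg := (log2 (n%:R : R)).

Lemma k_gt0 : 0 < k.
Proof. exact: lt_le_trans k1. Qed.

Lemma pow_g_le_k : (2 ^ g)%:R <= k.
Proof. by rewrite -powR2_nat -[leRHS]powR_log2 ?powR2_le // k_gt0. Qed.

Lemma k_ge2 : 2 <= k.
Proof.
apply: le_trans pow_g_le_k; rewrite (ler_nat R 2); case: (g) g1 => // j _.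
by rewrite expnS leq_pmulr // expn_gt0.
Qed.

Lemma g_le_k : g%:R <= k.
Proof. by apply: le_trans pow_g_le_k; rewrite ler_nat ltnW // ltn_expl. Qed.

Lemma n_gt0 : (0 < n)%N.
Proof.
case: n kn => // ; rewrite /log2 ln0 // mul0r; have := k1; lra.
Qed.

Lemma root_ge1 : 1 < powR ((k + 1) / 2) (g%:R^-1).
Proof.
have k2 := k_ge2; rewrite -[X in X < _](powRr0 ((k + 1) / 2)).
rewrite /powR; case: eqP => [|_]; first by lra.
rewrite ltr_expR mul0r mulr_gt0 ?invr_gt0 ?ltr0n //.
by apply: ln_gt0; lra.
Qed.

Lemma root_le : powR ((k + 1) / 2) (g%:R^-1) <= powR k (g%:R^-1).
Proof.
apply: ge0_ler_powR; rewrite ?invr_ge0 ?nnegrE //; have := k1; lra.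
Qed.

Lemma ceil_root : m = d.+1%:Z /\ (0 < d)%N.
Proof.
have : 1 < m by rewrite ceil_gt_int root_ge1.
by case: m => // -[|[|j]].
Qed.

Lemma passes_lt : ((g%:Z * (m - 1) + 1)%:~R : R) < g%:R * powR k (g%:R^-1) + 1.
Proof.
rewrite intrD intrM ltrD2r ltr_pM2l ?ltr0n //.
apply: lt_le_trans root_le; exact: ceilB1_lt.
Qed.

Lemma root_pow : (k + 1) / 2 <= (d.+1 ^ g)%:R.
Proof.
have [mE _] := ceil_root; have k2 := k_ge2.
have h := ceil_ge (powR ((k + 1) / 2) (g%:R^-1)); rewrite mE in h.
have : powR (powR ((k + 1) / 2) (g%:R^-1)) g%:R <= powR d.+1%:R g%:R.
  by apply: ge0_ler_powR; rewrite ?nnegrE ?powR_ge0 ?ler0n.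
rewrite -powRrM mulVf ?pnatr_eq0 -?lt0n // powRr1 ?powR_mulrn ?natrX //; lra.
Qed.

(** Both [g] and the root [k^(1/g)] are at most [k], hence at most [lg]. *)
Lemma passes_le : (g * d)%:R <= lg * lg.
Proof.
have [mE _] := ceil_root; have := passes_lt; rewrite mE.
have -> : (g%:Z * (d.+1%:Z - 1) + 1)%:~R = (g * d)%:R + 1 :> R.
  by rewrite intrD -[d.+1]addn1 PoszD addrK -PoszM.
rewrite ltrD2r => h; apply: le_trans (ltW h) _; apply: ler_pM; rewrite ?powR_ge0 //.
  exact: le_trans g_le_k kn.
apply: le_trans kn; apply: ler1_powR => //.
by rewrite invf_le1 ?ltr0n // ler1n.
Qed.
End PassCount.

Theorem theorem1p6 (R : realType) :
  exists (C : R) (a : nat) (c : R), 0 < C /\ 0 < c /\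
  forall (n : nat) (k : R) (g : nat),
    1 <= k -> k <= log2 (n%:R : R) ->
    (1 <= g)%N -> (g%:R : R) <= log2 k ->
    let m : int := Num.ceil (powR ((k + 1) / 2) (g%:R^-1)) in
    let passes : int := g%:Z * (m - 1) + 1 in
    let t : int := 2 * (2 * m - 1) ^+ g - 1 in
    let bound : R := C * powR (n%:R) (1 + k^-1) * (log2 (n%:R : R)) ^+ a in
    (passes%:~R < (g%:R : R) * powR k (g%:R^-1) + 1) /\
    exists (p s : nat) (A : stream_alg n s p),
      p%:Z = passes /\ (s%:R : R) <= bound /\
      forall str : seq (update n), valid_stream str ->
        (nfail (fun H => is_spanner (graph_of str) H t /\ (#|H|%:R : R) <= bound)
               A str)%:R
          <= (2 ^+ s)%:R * powR (n%:R) (- c).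
Proof.
have [K spaceK] := space_poly.
(* [L <= 2 lg] gives the factor [2 ^+ 7], and [n + W <= 3 P] the factor [3]; the exponent [1] holds
   as the failure probability is at most [2^-L < 1/n]. *)
exists (K.+1%:R * 2 ^+ 7 * 3), 7%N, 1; split.
  by rewrite !mulr_gt0 ?exprn_gt0 ?ltr0n.
split=> // n k g k1 kn g1 gk m passes t bound; split; first exact: passes_lt.
have n0 := n_gt0 k1 kn; have k2 := k_ge2 k1 g1 gk.
have [mE d0] := ceil_root k1 g1 gk.
set lg := log2 (n%:R : R) in kn bound *; pose d := `|m|.-1; rewrite -/m -/d in mE d0.
have lgE : powR 2 lg = n%:R by rewrite powR_log2 // ltr0n.
pose L := (trunc_log 2 n).+1.
have nL : (n < 2 ^ L)%N by apply: trunc_log_ltn.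
have Ln : (2 ^ L <= 2 * n)%N by rewrite expnS leq_mul2l /= trunc_logP.
have L0 : (0 < L)%N by [].
have lgL : lg <= L%:R by rewrite -powR2_le lgE powR2_nat ler_nat ltnW.
have Llg : L%:R <= 2 * lg.
  have : L%:R <= 1 + lg.
    rewrite -powR2_le powRD ?pnatr_eq0 ?implybT // lgE powR2_nat powRr1 //.
    by rewrite -natrM ler_nat.
  lra.
have kN0 : k != 0 by rewrite gt_eqF //; lra.
pose y := lg / k; have ky : k * y = lg by rewrite /y mulrC divfK.
have k0 : 0 <= k := le_trans ler01 k1.
have lg0 : 0 <= lg := le_trans k0 kn.
have y0 : 0 <= y by rewrite divr_ge0.
have gdL : (g * d <= L * L)%N.
  rewrite -(ler_nat R); apply: le_trans (passes_le k1 kn g1 gk) _.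
  by rewrite natrM ler_pM //; lra.
have [pL pL4] := succ_sqr_bounds L0 gdL.
pose W := Num.truncn (2 * powR 2 (lg + y)).
have kmu := root_pow k1 g1 gk.
have [A AP] := spanner_stream_alg L0 nL d0 pL4 (sched0 L d g y) (sched_le L g d0 y0)
  (sched_max L d g y) (sched_end d g y nL) (sched_space n0 lgE nL Ln d0 y0 ky kmu).
have NE : powR n%:R (1 + k^-1) = powR 2 (lg + y) :> R.
  by rewrite -lgE -powRrM mulrDr mulr1.
pose P := powR 2 (lg + y).
have nP : n%:R <= P by rewrite -lgE powR2_le lerDl.
have WP : W%:R <= 2 * P by rewrite truncn_le mulr_ge0 ?powR_ge0.
have spaceR x : (x <= K * (L ^ 7 * (n + W)))%N -> x%:R <= bound.
  move=> xK; apply: (@le_trans _ _ (K * (L ^ 7 * (n + W)))%:R); first by rewrite ler_nat.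
  have -> : bound = K.+1%:R * ((2 * lg) ^+ 7 * (3 * P)).
    have E (u v w x' : R) : u * v * 3 * w * x' = u * (v * x' * (3 * w)) by ring.
    by rewrite /bound NE (exprMn _ 2 lg); apply: E.
  rewrite (natrM _ K) (natrM _ (L ^ 7)) natrX natrD; apply: ler_pM => //.
  - by rewrite mulr_ge0 ?exprn_ge0 ?addr_ge0.
  - by rewrite ler_nat.
  apply: ler_pM; rewrite ?exprn_ge0 ?addr_ge0 //.
    by apply: lerXn2r => //; rewrite nnegrE; [exact: ler0n | exact: mulr_ge0].
  by apply: le_trans (lerD nP WP) _; rewrite -[X in X + _]mul1r -mulrDl lexx.
have total_le := spaceK n L _ W L0 n0 pL.
exists (g * d).+1, _, A; split; last split.
- by rewrite /passes mE -[X in X%:Z - 1]addn1 PoszD addrK -PoszM -addn1 PoszD.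
- exact: spaceR total_le.
move=> str vs.
have tE : t = Posz (2 * d.*2.+1 ^ g - 1).
  rewrite /t mE -subzn ?PoszM ?muln_gt0 ?expn_gt0 //; congr (_ * _ - _).
  have -> : 2 * d.+1%:Z - 1 = d.*2.+1%:Z by clear; lia.
  by rewrite -[RHS]natz natrX natz.
have := AP str vs; set s := (_ + _ + _)%N; set N1 := nfail _ A str; set N2 := nfail _ A str.
have NN : (N2 <= N1)%N.
  rewrite /N2 /N1 /nfail; apply: subset_leq_card; apply/subsetP => seed.
  rewrite !inE; apply: contra => /asboolP[sp hH]; apply/asboolP; rewrite tE; split => //.
  (* The edge bound follows from the space bound, as the state stores the edges of [H]. *)
  apply: spaceR; apply: leq_trans total_le; apply: (leq_trans hH).
  apply: leq_trans (leq_addr _ _); apply: leq_trans (leq_addl _ _).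
  by apply: leq_trans (leq_addl _ _); rewrite leq_pmull // muln_gt0.
move=> N1L; rewrite powR_inv1 // ler_pdivlMr ?ltr0n // -natrM ler_nat natrXE.
apply: leq_trans N1L; apply: leq_mul => //; exact: ltnW.
Qed.
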